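(* Let $n\ge 0$, let $F(n)=\mathbb F_2\{\mathrm{Sq}(R)\mid r_1=\cdots=r_n=0\}\subset A$, where $A$ is the mod $2$ Steenrod algebra, and let $B\subset F(n)$ be an admissible sub Hopf algebra of $A$. Let $C_*$ be a partially complete resolution below bidegree $(s,t)$, where $t<(2^{n+1}-1)s$. Then the signature algorithm (described in the context) is applicable to $C_*$, $B$ and $(s,t)$: every linear system $M\cdot f_i=e_i$ occurring in it is solvable, at the end all $d_i$ are $0$, and the complex $C'_*$ obtained from $C_*$ by introducing the new generators $g_i\in C'_{s+1,t}$ with $dg_i=x_i$ is an extension of the resolution to $(s,t)$, that is, $H(C'_* )_{p,q}=0$ for all $(p,q)\neq(0,0)$ with $p<s$ or $q<t$ or $(p,q)=(s,t)$.
   Context: Let $k=\mathbb F_2$ and let $A$ be the mod $2$ Steenrod algebra with Milnor basis $\mathrm{Sq}(R)=\mathrm{Sq}(r_1,r_2,\dots)$ of degree $|R|=|\mathrm{Sq}(R)|=\sum_i r_i(2^i-1)$. $P_t^s$ denotes $\mathrm{Sq}(R)$ with $r_t=2^s$ and all other $r_i=0$. Partial resolutions. $C_*$ is a chain complex of free graded left $A$-modules $C_s$ ($s\ge 0$, $C_{-1}=0$), each with a chosen homogeneous basis $G_s$, with finitely many elements in each degree, all of degree $\ge 0$; $d:C_s\to C_{s-1}$ is $A$-linear and preserves the internal degree. $C_{s,t}$ is the part of $C_s$ of internal degree $t$. $C_*$ is a partially complete resolution (of $k$) below $(s,t)$ if $H(C_* )_{p,q}=0$ whenever $p<s$ or $q<t$,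 except that $H(C_* )_{0,0}=k$; the group $H(C_* )_{s,t}$ itself may be nonzero. Admissible subalgebras and signatures. A finite sub Hopf algebra $B\subset A$ is described by a profile function $p$, i.e. $B$ has basis the $\mathrm{Sq}(R)$ with $0\le r_j<2^{p(j)}$ for all $j\ge1$. $B$ is admissible if it is finite and $p(i+j)\ge p(i)-j$ for all $i,j\ge 1$. Let $\mathcal S_B=\{R \mid \mathrm{Sq}(R)\in B\}$. For any $S$, $\mathrm{sig}_B(S)$ is the unique $R\in\mathcal S_B$ with $S_j\equiv R_j \bmod 2^{p(j)}$ for all $j$. Order the set of all $P_t^s\in B$ as $P_{t_1}^{s_1}>\dots>P_{t_n}^{s_n}$ with $P_t^s<P_{t'}^{s'}$ whenever $t<t'$; write $r_j=\sum_{t_k=j}2^{s_k}\varepsilon_k$ with $\varepsilon_k\in\{0,1\}$ for $R\in\mathcal S_B$, and order $\mathcal S_B$ by the lexicographic order of $(\varepsilon_1,\dots,\varepsilon_n)$ (here $n$ is just the number of $P_t^s$ in $B$). Put $E_RA=\mathbb F_2\{\mathrm{Sq}(S)\mid \mathrm{sig}_B(S)=R\}$ and $F_RA=\sum_{S\in\mathcal S_B,\,S\ge R}E_SA$. With this ordering each $F_RA$ is a right $A$-submodule of $A$, so $F_RC_*=F_RA\otimes_A C_*$ defines a filtration of $C_*$ by subcomplexes of $k$-vector spaces. As a vector space $C_*$ is the direct sum of the subspaces $E_RC_*$ spanned by the $\mathrm{Sq}(S)g$ with $g\in G_*$ and $\mathrm{sig}_B(S)=R$, and $E_RC_*$ carries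 the differential induced by identifying it with the quotient of $F_RC_*$ by $\sum_{S>R}F_SC_*$. $E_0$ denotes $E_R$ for $R=0$, the smallest signature. The signature algorithm. Input: a partial resolution $C_*$ below $(s,t)$ and an admissible $B$. (1) Compute the kernel $K$ of $d:E_0C_{s,t}\to E_0C_{s-1,t}$ and choose a basis $\{q_i\}$ of $K/\mathrm{im}(d:E_0C_{s+1,t}\to E_0C_{s,t})=H(E_0C_* )_{s,t}$. (2) For each $q_i$ choose a representative $x_i\in E_0C_{s,t}\subset C_{s,t}$ and let $d_i=d(x_i)\in C_{s-1,t}$, where $d$ is the differential of $C_*$. (3) For each $R\in\mathcal S_B$, $R\ne 0$, in increasing order: let $M$ be the matrix of the induced differential $d:E_RC_{s,t}\to E_RC_{s-1,t}$; for each $i$ let $e_i$ be the component of $d_i$ in $E_RC_{s-1,t}$, choose a solution $f_i\in E_RC_{s,t}$ of $M\cdot f_i=e_i$, and replace $x_i$ by $x_i-f_i$ and $d_i$ by $d_i-d(f_i)$ (with $d$ the differential of $C_*$). (4) Verify that all $d_i=0$ and introduce for each $i$ a new free generator $g_i$ of homological degree $s+1$ and internal degree $t$ with $dg_i=x_i$. *)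

(* Defs.v *)
From HB Require Import structures.
From mathcomp Require Import all_boot all_order all_algebra.
From mathcomp Require Import finmap.
From mathcomp.multinomials Require Import monalg.

Set Implicit Arguments.
Unset Strict Implicit.
Unset Printing Implicit Defensive.

Import GRing.Theory.
Local Open Scope ring_scope.

(* Componentwise product of commutative monoids; the monoid algebra of
   [M * N] is the tensor product of the monoid algebras of [M] and [N]. *)
Section PairMonom.
Variables M N : conomType.
Implicit Types u v : M * N.

Definition pair_one : M * N := (mone, mone).
Definition pair_mul u v : M * N := (mmul u.1 v.1, mmul u.2 v.2).

Fact pair_mulA : associative pair_mul.
Proof. by move=> u v w; rewrite /pair_mul /= !mulmA. Qed.
Fact pair_mul1 : left_id pair_one pair_mul.
Proof. by case=> a b; rewrite /pair_mul /= !mul1m. Qed.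
Fact pair_mulr1 : right_id pair_one pair_mul.
Proof. by case=> a b; rewrite /pair_mul /= !mulm1. Qed.
Fact pair_unit u v : pair_mul u v = pair_one -> u = pair_one /\ v = pair_one.
Proof. by case: u v => [a b] [c d] [/unitm[-> ->] /unitm[-> ->]]. Qed.
Fact pair_mulC : commutative pair_mul.
Proof. by move=> u v; rewrite /pair_mul mulmC [X in (_, X)]mulmC. Qed.

HB.instance Definition _ := Choice_isMonomialDef.Build (M * N)%type
  pair_mulA pair_mul1 pair_mulr1 pair_unit.
HB.instance Definition _ :=
  MonomialDef_isConomialDef.Build (M * N)%type pair_mulC.
End PairMonom.

(* Exponent sequences [R = (r_1, r_2, ...)]; [r_(i+1)] is stored at index [i]. *)
Notation expo := {cmonom nat}.

Definition rr (R : expo) (j : nat) : nat := R j.-1.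

Definition sqdeg (R : expo) : nat :=
  (\sum_(i <- finsupp R) R i * (2 ^ i.+1).-1)%N.

Section Points.
Variable K : comNzRingType.
Implicit Types (a b : nat -> K) (R S : expo).

(* The value of the monomial [xi^R] at the point [xi_n = a n] (n >= 1). *)
Definition xipow a (R : expo) : K := \prod_(i <- finsupp R) a i.+1 ^+ R i.

(* Milnor's formula  Delta xi_n = sum_i xi_(n-i)^(2^i) (x) xi_i,  xi_0 = 1. *)
Definition milnor a b (n : nat) : K :=
  \sum_(0 <= i < n.+1) a (n - i)%N ^+ (2 ^ i) * b i.

Lemma xipowEw a R (E : {fset nat}) : (finsupp R `<=` E)%fset ->
  xipow a R = \prod_(i <- E) a i.+1 ^+ R i.
Proof.
move=> le; rewrite /xipow (big_fset_incl _ le) //= => i _.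
by rewrite -cmE_eq0 => /eqP->.
Qed.

Lemma xipow1 a : xipow a mone = 1.
Proof. by rewrite /xipow mdom1 big_seq_fset0. Qed.

Lemma xipowM a R S : xipow a (mmul R S) = xipow a R * xipow a S.
Proof.
rewrite [LHS]/xipow mdomD (xipowEw a (fsubsetUl (finsupp R) (finsupp S))).
rewrite (xipowEw a (fsubsetUr (finsupp R) (finsupp S))) -big_split /=.
by apply: eq_bigr => i _; rewrite cmM exprD.
Qed.

Lemma xipowU a i : xipow a (ucm i) = a i.+1.
Proof. by rewrite /xipow mdomU big_seq_fset1 cmUU expr1. Qed.

Lemma eq_xipow a b R : (forall n, (0 < n)%N -> a n = b n) ->
  xipow a R = xipow b R.
Proof. by move=> ab; apply: eq_bigr => i _; rewrite ab. Qed.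

Lemma eq_milnor a b a' b' n : a =1 a' -> b =1 b' ->
  milnor a b n = milnor a' b' n.
Proof. by move=> aa bb; apply: eq_bigr => i _; rewrite aa bb. Qed.

Hypothesis K2 : 2%N \in [pchar K].

Lemma milnorA a b c n :
  milnor (milnor a b) c n = milnor a (milnor b c) n.
Proof.
have F2 i (I : seq nat) (F : nat -> K) :
  (\sum_(j <- I) F j) ^+ (2 ^ i) = \sum_(j <- I) F j ^+ (2 ^ i).
  elim: I => [|j I IH]; first by rewrite !big_nil expr0n expn_eq0.
  rewrite !big_cons exprDn_pchar ?IH //.
  by rewrite pnatX (eq_pnat _ (pcharf_eq K2)) pnat_id.
rewrite /milnor.
transitivity (\sum_(0 <= i < n.+1) \sum_(0 <= k < n.+1 | (i <= k)%N)
   a (n - k)%N ^+ (2 ^ k) * (b (k - i)%N ^+ (2 ^ i) * c i)).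
  apply: eq_big_nat => i /andP[_ lin]; rewrite F2 big_distrl /=.
  transitivity (\sum_(i <= k < n.+1)
    a (n - k)%N ^+ (2 ^ k) * (b (k - i)%N ^+ (2 ^ i) * c i)); last first.
    by rewrite (big_nat_widenl i 0).
  rewrite -[X in _ = \big[_/_]_(X <= _ < _) _]add0n big_addn subSn //.
  apply: eq_bigr => j _.
  by rewrite exprMn -exprM -expnD addnK mulrA subnDA subnAC addnC.
rewrite (exchange_big_dep_nat xpredT) //=; apply: eq_big_nat => k /andP[_ lkn].
rewrite big_distrr /= [RHS](big_nat_widen _ _ n.+1) //.
Qed.
End Points.

Lemma rmorph_xipow (K L : comNzRingType) (f : {rmorphism K -> L})
    (a : nat -> K) R : f (xipow a R) = xipow (f \o a) R.
Proof. by rewrite rmorph_prod; apply: eq_bigr => i _; rewrite rmorphXn. Qed.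

Lemma rmorph_milnor (K L : comNzRingType) (f : {rmorphism K -> L})
    (a b : nat -> K) n : f (milnor a b n) = milnor (f \o a) (f \o b) n.
Proof.
rewrite rmorph_sum; apply: eq_bigr => i _.
by rewrite rmorphM rmorphXn.
Qed.

Lemma expo_ind (P : expo -> Prop) :
  P mone -> (forall i R, P R -> P (mmul (ucm i) R)) -> forall R, P R.
Proof.
move=> P1 PM R; move: {2}(mdeg R) (leqnn (mdeg R)) => d.
elim: d R => [|d IH] R; first by rewrite leqn0 => /eqP /mdeg_eq0I->.
case: (eqVneq R mone) => [->//|Rn1] dR.
have [i Ri] : exists i, R i != 0%N.
  case: (fset_0Vmem (finsupp R)) => [R0|[i iR]]; last first.
    by exists i; rewrite cmE_neq0.
  by case/eqP: Rn1; apply: mdeg_eq0I; rewrite mdegE R0 big_seq_fset0.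
have RE : R = mmul (ucm i) (divcm R (ucm i)).
  apply/eqP/cmP => j; rewrite cmM divcmE cmU.
  case: eqVneq => [<-|_] /=; last by rewrite subn0.
  by rewrite subnKC // lt0n.
by move: dR; rewrite RE mdegM mdegU => dR; apply/PM/IH.
Qed.

(* The dual Steenrod algebra tensored with itself, with basis the
   xi^R (x) xi^S indexed by the pairs (R, S). *)
Notation dual2 := {malg 'F_2[(expo * expo)%type]}.

Definition xi_left (n : nat) : dual2 :=
  if n is i.+1 then << (ucm i, mone) >> else 1.
Definition xi_right (n : nat) : dual2 :=
  if n is i.+1 then << (mone, ucm i) >> else 1.

(* The coproduct Delta (xi^T) of the dual Steenrod algebra. *)
HB.lock Definition dual_coproduct (T : expo) : dual2 :=
  xipow (milnor xi_left xi_right) T.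

Lemma malgUU (N : conomType) (u v : N) :
  << u >> * << v >> = << mmul u v >> :> {malg 'F_2[N]}.
Proof. by rewrite malgM_def fgmulUU mulr1. Qed.

Lemma xipow_gen (N : conomType) (f : expo -> N) (a : nat -> {malg 'F_2[N]}) :
  f mone = mone -> (forall R S, f (mmul R S) = mmul (f R) (f S)) ->
  (forall i, a i.+1 = << f (ucm i) >>) -> forall R, xipow a R = << f R >>.
Proof.
move=> f1 fM fa; elim/expo_ind => [|i R IH]; first by rewrite xipow1 f1.
by rewrite xipowM xipowU fa IH fM malgUU.
Qed.

Lemma pchar_malg (N : conomType) : 2%N \in [pchar {malg 'F_2[N]}].
Proof.
rewrite inE /= -mpolyC_nat.
by have /eqP-> : 2%:R == 0 :> 'F_2 by []; rewrite malgC0E.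
Qed.

Section Hom2.
Variables (N : conomType) (a b : nat -> {malg 'F_2[N]}).

Definition xipow2 (u : expo * expo) := xipow a u.1 * xipow b u.2.

Fact xipow2_mmorphism : mmorphism xipow2.
Proof.
split=> [[R S] [R' S']|]; last by rewrite /xipow2 !xipow1 mulr1.
transitivity (xipow a (mmul R R') * xipow b (mmul S S')); first by [].
rewrite (xipowM a R R').
rewrite (xipowM b S S').
exact: mulrACA.
Qed.
HB.instance Definition _ :=
  isMultiplicative.Build _ _ xipow2 xipow2_mmorphism.

Definition hom2 : dual2 -> {malg 'F_2[N]} := mmap (@malgC N 'F_2) xipow2.
HB.instance Definition _ := GRing.RMorphism.on hom2.

Lemma hom2U u : hom2 << u >> = xipow2 u.
Proof. by rewrite /hom2 mmapU mul1r. Qed.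

Lemma hom2_coproduct T : a 0%N = 1 -> b 0%N = 1 ->
  hom2 (dual_coproduct T) = xipow (milnor a b) T.
Proof.
move=> a0 b0.
have hl i : hom2 (xi_left i) = a i.
  case: i => [|i] /=; first by rewrite rmorph1.
  by rewrite hom2U /xipow2 /= xipowU xipow1 mulr1.
have hr i : hom2 (xi_right i) = b i.
  case: i => [|i] /=; first by rewrite rmorph1.
  by rewrite hom2U /xipow2 /= xipowU xipow1 mul1r.
rewrite dual_coproduct.unlock rmorph_xipow; apply: eq_xipow => n _.
etransitivity; first exact: (rmorph_milnor hom2).
exact: eq_milnor hl hr.
Qed.
End Hom2.

Definition expo_of (d : nat) (s : {ffun 'I_d -> 'I_d.+1}) : expo :=
  [cmonom oapp (fun j : 'I_d => val (s j)) 0%N (insub i)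
     | i in seq_fset tt (iota 0 d)]%M.

(* Contains all exponent sequences of degree [d], so that products are finite
   sums. *)
Definition sqdeg_fset (d : nat) : {fset expo} :=
  [fset expo_of s | s in {: {ffun 'I_d -> 'I_d.+1}}]%fset.

Lemma sqdegEw (R : expo) (E : {fset nat}) : (finsupp R `<=` E)%fset ->
  sqdeg R = (\sum_(i <- E) R i * (2 ^ i.+1).-1)%N.
Proof.
move=> le; rewrite /sqdeg (big_fset_incl _ le) //= => i _.
by rewrite -cmE_eq0 => /eqP->.
Qed.

Lemma sqdegM R S : sqdeg (mmul R S) = (sqdeg R + sqdeg S)%N.
Proof.
rewrite [LHS]/sqdeg mdomD (sqdegEw (fsubsetUl (finsupp R) (finsupp S))).
rewrite (sqdegEw (fsubsetUr (finsupp R) (finsupp S))) -big_split /=.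
by apply: eq_bigr => i _; rewrite cmM mulnDl.
Qed.

Lemma sqdeg1 : sqdeg mone = 0%N.
Proof. by rewrite /sqdeg mdom1 big_seq_fset0. Qed.

Lemma sqdegU i : sqdeg (ucm i) = (2 ^ i.+1).-1.
Proof. by rewrite /sqdeg mdomU big_seq_fset1 cmUU mul1n. Qed.

Lemma mem_sqdeg_fset R : R \in sqdeg_fset (sqdeg R).
Proof.
set d := sqdeg R.
have Rd i : (R i * (2 ^ i.+1).-1 <= d)%N.
  case: (boolP (i \in finsupp R)) => [iR|]; last first.
    by rewrite -cmE_eq0 => /eqP->.
  by rewrite /d /sqdeg (big_fsetD1 i) //= leq_addr.
have pos i : (0 < (2 ^ i.+1).-1)%N.
  by rewrite -subn1 subn_gt0 -{1}(expn0 2) ltn_exp2l.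
have Rb i : (R i < d.+1)%N.
  by rewrite ltnS (leq_trans _ (Rd i)) // leq_pmulr.
have R0 i : (d <= i)%N -> R i = 0%N.
  move=> di; apply/eqP; apply: contraTT (Rd i); rewrite -lt0n -ltnNge => Ri.
  rewrite (leq_ltn_trans di) // (@leq_trans (2 ^ i.+1).-1) ?leq_pmull //.
  by rewrite -ltnS prednK ?expn_gt0 // ltn_expl.
apply/imfsetP; exists [ffun j : 'I_d => Ordinal (Rb j)] => //=.
apply/eqP/cmP => i; rewrite /expo_of cmE fsfun_fun seq_fsetE mem_iota add0n /=.
case: ltnP => di; last exact: R0.
by rewrite insubT /= ffunE.
Qed.

Definition sqdeg2 (u : expo * expo) : nat := (sqdeg u.1 + sqdeg u.2)%N.

Definition homog2 (d : nat) (x : dual2) : Prop :=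
  forall u, x@_u != 0 -> sqdeg2 u = d.

Lemma homog2_1 : homog2 0 1.
Proof.
move=> u; rewrite mcoeff1; case: (u =P mone) => [-> _|_ /eqP //].
by rewrite /sqdeg2 /= sqdeg1.
Qed.

Lemma homog2_U u : homog2 (sqdeg2 u) << u >>.
Proof. by move=> v; rewrite mcoeffU; case: (u =P v) => [->|_ /eqP]. Qed.

Lemma homog2_M d e x y : homog2 d x -> homog2 e y -> homog2 (d + e) (x * y).
Proof.
move=> hx hy u; rewrite mcoeff_neq0 => /msuppM_le [v [w [vx wy ->]]].
rewrite -(hx v) ?mcoeff_neq0 // -(hy w) ?mcoeff_neq0 //.
by rewrite /sqdeg2 /= !sqdegM addnACA.
Qed.

Lemma homog2_X d x n : homog2 d x -> homog2 (d * n) (x ^+ n).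
Proof.
move=> hx; elim: n => [|n IH]; first by rewrite muln0 expr0; apply: homog2_1.
by rewrite exprS mulnS; apply: homog2_M.
Qed.

Lemma homog2_coproduct T : homog2 (sqdeg T) (dual_coproduct T).
Proof.
rewrite dual_coproduct.unlock; elim/expo_ind: T => [|k T IH].
  by rewrite xipow1 sqdeg1; apply: homog2_1.
rewrite xipowM xipowU sqdegM sqdegU; apply: homog2_M => //.
move=> u; rewrite /milnor raddf_sum /= => nz.
have [/eqP z|[i lei nzi]] : (\sum_(0 <= i < k.+2)
   (xi_left (k.+1 - i)%N ^+ (2 ^ i) * xi_right i)@_u == 0) \/
   exists2 i, (i <= k.+1)%N &
     (xi_left (k.+1 - i)%N ^+ (2 ^ i) * xi_right i)@_u != 0.
- case: eqP => [_|/eqP nz']; first by left.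
  right; case: (boolP (has (fun i => (xi_left (k.+1 - i)%N ^+ (2 ^ i)
     * xi_right i)@_u != 0) (index_iota 0 k.+2))) => [/hasP[i]|/hasPn h0].
    by rewrite mem_index_iota ltnS => /= hi nzi; exists i.
  case/eqP: nz'; rewrite big_seq big1 // => i /h0.
  by rewrite negbK => /eqP.
- by rewrite z eqxx in nz.
have hl n : homog2 (2 ^ n).-1 (xi_left n).
  case: n => [|n] /=; first exact: homog2_1.
  by have := @homog2_U (ucm n, mone); rewrite /sqdeg2 /= sqdegU sqdeg1 addn0.
have hr n : homog2 (2 ^ n).-1 (xi_right n).
  case: n => [|n] /=; first exact: homog2_1.
  by have := @homog2_U (mone, ucm n); rewrite /sqdeg2 /= sqdegU sqdeg1 add0n.
have := homog2_M (@homog2_X _ _ (2 ^ i)%N (hl (k.+1 - i)%N)) (hr i) nzi.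
rewrite -!subn1 mulnBl mul1n -expnD subnK // => ->.
by rewrite addnBA ?expn_gt0 // subnK // leq_exp2l.
Qed.

Section Pairing.
Variables (K : choiceType) (f : K -> 'F_2).

Definition pairing (x : {malg 'F_2[K]}) : 'F_2 := \sum_(k <- msupp x) x@_k * f k.

Lemma pairingEw x (E : {fset K}) : (msupp x `<=` E)%fset ->
  pairing x = \sum_(k <- E) x@_k * f k.
Proof.
move=> le; rewrite /pairing (big_fset_incl _ le) //= => k _.
by move/mcoeff_outdom->; rewrite mul0r.
Qed.

Fact pairing_is_additive : zmod_morphism pairing.
Proof.
move=> x y; have lx := fsubsetUl (msupp x) (msupp y).
have ly := fsubsetUr (msupp x) (msupp y).
rewrite (pairingEw lx) (pairingEw ly) (pairingEw (msuppB_le x y)) -sumrB.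
by apply: eq_bigr => k _; rewrite mcoeffB mulrBl.
Qed.
HB.instance Definition _ := GRing.isZmodMorphism.Build {malg 'F_2[K]} 'F_2
  pairing pairing_is_additive.

Lemma pairingU c k : pairing << c *g k >> = c * f k.
Proof. by rewrite (pairingEw msuppU_le) big_seq_fset1 mcoeffUU. Qed.
End Pairing.

(* The Steenrod algebra is the graded dual of its dual: an element is a finite
   combination of the functionals Sq(R) dual to the monomials xi^R, and the
   coefficient of Sq(T) in a product is obtained by evaluating the factors on
   Delta (xi^T).  (A wrapper, so as not to inherit the product of the monoid
   algebra.) *)
Record steenrod : Type := Steenrod { scoef : {malg 'F_2[expo]} }.

Section SteenrodModule.
Implicit Types (a b : steenrod) (c : 'F_2).

HB.instance Definition _ := [isNew for scoef].
HB.instance Definition _ := [Choice of steenrod by <:].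

Definition steenrod_zero := Steenrod 0.
Definition steenrod_add a b := Steenrod (scoef a + scoef b).
Definition steenrod_opp a := Steenrod (- scoef a).
Definition steenrod_scale c a := Steenrod (c *: scoef a).

Fact steenrod_addA : associative steenrod_add.
Proof. by move=> a b c; congr Steenrod; apply: addrA. Qed.
Fact steenrod_addC : commutative steenrod_add.
Proof. by move=> a b; congr Steenrod; apply: addrC. Qed.
Fact steenrod_add0 : left_id steenrod_zero steenrod_add.
Proof. by move=> a; apply: val_inj; apply: add0r. Qed.
Fact steenrod_addN : left_inverse steenrod_zero steenrod_opp steenrod_add.
Proof. by move=> a; apply: val_inj; apply: addNr. Qed.
HB.instance Definition _ := GRing.isZmodule.Build steenrod
  steenrod_addA steenrod_addC steenrod_add0 steenrod_addN.

Fact steenrod_scaleA c c' a :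
  steenrod_scale c (steenrod_scale c' a) = steenrod_scale (c * c') a.
Proof. by apply: val_inj; apply: scalerA. Qed.
Fact steenrod_scale1 : left_id 1 steenrod_scale.
Proof. by move=> a; apply: val_inj; apply: scale1r. Qed.
Fact steenrod_scaleDr : right_distributive steenrod_scale +%R.
Proof. by move=> c a b; apply: val_inj; apply: scalerDr. Qed.
Fact steenrod_scaleDl a : {morph steenrod_scale^~ a : c c' / c + c'}.
Proof. by move=> c c'; apply: val_inj; apply: scalerDl. Qed.
HB.instance Definition _ := GRing.Zmodule_isLmodule.Build 'F_2 steenrod
  steenrod_scaleA steenrod_scale1 steenrod_scaleDr steenrod_scaleDl.

Fact scoef_is_zmod_morphism : zmod_morphism scoef. Proof. by []. Qed.
HB.instance Definition _ :=
  GRing.isZmodMorphism.Build steenrod {malg 'F_2[expo]} scoef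
    scoef_is_zmod_morphism.
Fact scoef_is_scalable : scalable scoef. Proof. by []. Qed.
HB.instance Definition _ :=
  GRing.isScalable.Build 'F_2 steenrod {malg 'F_2[expo]} _ scoef
    scoef_is_scalable.
End SteenrodModule.

Lemma scoefD a b R : (scoef (a + b))@_R = (scoef a)@_R + (scoef b)@_R.
Proof. exact: mcoeffD. Qed.
Lemma scoefZ (c : 'F_2) a R : (scoef (c *: a))@_R = c * (scoef a)@_R.
Proof. exact: mcoeffZ. Qed.

Definition Sq (R : expo) : steenrod := Steenrod << R >>.

Definition Sq_mul (R S : expo) : {malg 'F_2[expo]} :=
  [malg T in sqdeg_fset (sqdeg R + sqdeg S) => (dual_coproduct T)@_(R, S)].

HB.lock Definition steenrod_mul (a b : steenrod) : steenrod :=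
  Steenrod (\sum_(R <- msupp (scoef a)) \sum_(S <- msupp (scoef b))
    ((scoef a)@_R * (scoef b)@_S) *: Sq_mul R S).

Lemma Sq_mulE R S T : (Sq_mul R S)@_T = (dual_coproduct T)@_(R, S).
Proof.
rewrite mcoeffE; case: ifP => // /negP nT.
apply/esym/eqP/negPn/negP => nz; case: nT.
by have := homog2_coproduct nz; rewrite /sqdeg2 /= => ->; apply: mem_sqdeg_fset.
Qed.

Lemma steenrodP (a b : steenrod) :
  (forall R, (scoef a)@_R = (scoef b)@_R) -> a = b.
Proof. by move=> ab; apply: val_inj; apply/malgP. Qed.

Lemma mcoeff_sum1 (K : choiceType) (a : {malg 'F_2[K]}) (k : K) :
  \sum_(j <- msupp a) a@_j *+ (j == k) = a@_k.
Proof.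
rewrite [in RHS](monalgE a) raddf_sum /=; apply: eq_bigr => j _.
by rewrite mcoeffU.
Qed.

Lemma steenrod_mulE (a b : steenrod) T : (scoef (steenrod_mul a b))@_T =
  pairing (fun u => (scoef a)@_u.1 * (scoef b)@_u.2) (dual_coproduct T).
Proof.
rewrite steenrod_mul.unlock /= raddf_sum /=.
transitivity (\sum_(R <- msupp (scoef a)) \sum_(S <- msupp (scoef b))
   \sum_(u <- msupp (dual_coproduct T))
      (dual_coproduct T)@_u * (((scoef a)@_R *+ (R == u.1)) * ((scoef b)@_S *+ (S == u.2)))).
  apply: eq_bigr => R _; rewrite raddf_sum /=; apply: eq_bigr => S _.
  rewrite mcoeffZ Sq_mulE -[X in _ * X]mcoeff_sum1 big_distrr /=.
  apply: eq_bigr => -[U V] _ /=.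
  rewrite xpair_eqE [U == R]eq_sym [V == S]eq_sym.
  case: (R == U); case: (S == V); rewrite /= ?mulr1n ?mulr0n ?mul0r ?mulr0 //.
  exact: mulrC.
rewrite /pairing.
under eq_bigr do rewrite exchange_big.
rewrite exchange_big /=; apply: eq_bigr => u _.
rewrite -(mcoeff_sum1 (scoef a)) -(mcoeff_sum1 (scoef b)) big_distrl big_distrr /=.
apply: eq_bigr => R _; rewrite big_distrr big_distrr /=.
by apply: eq_bigr => S _.
Qed.

Lemma eq_pairing (K : choiceType) (f g : K -> 'F_2) x :
  f =1 g -> pairing f x = pairing g x.
Proof. by move=> fg; apply: eq_bigr => k _; rewrite fg. Qed.

Lemma pairing_mulr (K : choiceType) (f : K -> 'F_2) c x :
  pairing f x * c = pairing (fun k => f k * c) x.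
Proof. by rewrite big_distrl; apply: eq_bigr => k _; rewrite /= mulrA. Qed.

Lemma pairing_mull (K : choiceType) (f : K -> 'F_2) c x :
  c * pairing f x = pairing (fun k => c * f k) x.
Proof. by rewrite big_distrr; apply: eq_bigr => k _; rewrite /= mulrCA. Qed.

Lemma malg_F2_ext (K : choiceType) (V : zmodType)
    (f g : {additive {malg 'F_2[K]} -> V}) :
  (forall k, f << k >> = g << k >>) -> forall x, f x = g x.
Proof.
move=> fg x; rewrite (monalgE x) !raddf_sum; apply: eq_bigr => k _.
have [->|->] : x@_k = 0 \/ x@_k = 1.
  by case: (x@_k) => -[|[|[]]] // i; [left|right]; apply: val_inj.
  by rewrite monalgU0 !raddf0.
exact: fg.
Qed.

Section Coassoc.
Notation dual3 := {malg 'F_2[(expo * expo * expo)%type]}.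

Variables y1 y2 y3 : nat -> dual3.
Hypotheses (y10 : y1 0%N = 1) (y20 : y2 0%N = 1) (y30 : y3 0%N = 1).
Hypothesis y1S : forall i, y1 i.+1 = << (ucm i, mone, mone) >>.
Hypothesis y2S : forall i, y2 i.+1 = << (mone, ucm i, mone) >>.
Hypothesis y3S : forall i, y3 i.+1 = << (mone, mone, ucm i) >>.

Fact xipow_y1 R : xipow y1 R = << (R, mone, mone) >>.
Proof.
apply: (xipow_gen (f := fun R : expo => (R, mone, mone)) _ _ y1S) => // S T.
by transitivity (mmul S T, mmul (mone : expo) mone, mmul (mone : expo) mone); first rewrite !mul1m.
Qed.
Fact xipow_y2 R : xipow y2 R = << (mone, R, mone) >>.
Proof.
apply: (xipow_gen (f := fun R : expo => (mone, R, mone)) _ _ y2S) => // S T.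
by transitivity (mmul (mone : expo) mone, mmul S T, mmul (mone : expo) mone); first rewrite !mul1m.
Qed.
Fact xipow_y3 R : xipow y3 R = << (mone, mone, R) >>.
Proof.
apply: (xipow_gen (f := fun R : expo => (mone, mone, R)) _ _ y3S) => // S T.
by transitivity (mmul (mone : expo) mone, mmul (mone : expo) mone, mmul S T); first rewrite !mul1m.
Qed.

Fact xipow_y R S T : xipow y1 R * xipow y2 S * xipow y3 T = << (R, S, T) >>.
Proof.
rewrite xipow_y1 xipow_y2 xipow_y3 !malgUU; congr << _ >>.
transitivity (mmul (mmul R mone) mone, mmul (mmul mone S) mone,
              mmul (mmul mone mone) T); first by [].
by rewrite !mulm1 !mul1m.
Qed.

Fact milnor0 (K : comNzRingType) (a b : nat -> K) :
  a 0%N = 1 -> b 0%N = 1 -> milnor a b 0 = 1.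
Proof. by move=> a0 b0; rewrite /milnor big_nat1 a0 b0 expr1n mulr1. Qed.

Fact hom2_left f x : pairing f (hom2 (milnor y1 y2) y3 x) =
  pairing (fun u => pairing (fun v => f (v.1, v.2, u.2)) (dual_coproduct u.1)) x.
Proof.
apply: (malg_F2_ext (f := pairing f \o hom2 (milnor y1 y2) y3)) => -[U Q] /=.
rewrite hom2U /xipow2 pairingU mul1r /= -(@hom2_coproduct _ y1 y2) //.
apply: (malg_F2_ext (f := pairing f \o (xipow y3 Q \o* hom2 y1 y2))) => -[R S] /=.
by rewrite hom2U /xipow2 /= xipow_y !pairingU.
Qed.

Fact hom2_right f x : pairing f (hom2 y1 (milnor y2 y3) x) =
  pairing (fun u => pairing (fun v => f (u.1, v.1, v.2)) (dual_coproduct u.2)) x.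
Proof.
apply: (malg_F2_ext (f := pairing f \o hom2 y1 (milnor y2 y3))) => -[U Q] /=.
rewrite hom2U /xipow2 pairingU mul1r /= -(@hom2_coproduct _ y2 y3) //.
apply: (malg_F2_ext (f := pairing f \o (xipow y1 U \*o hom2 y2 y3))) => -[R S] /=.
by rewrite hom2U /xipow2 /= mulrA xipow_y !pairingU.
Qed.

Fact coassoc_at f T :
  pairing (fun u => pairing (fun v => f (v.1, v.2, u.2)) (dual_coproduct u.1))
    (dual_coproduct T) =
  pairing (fun u => pairing (fun v => f (u.1, v.1, v.2)) (dual_coproduct u.2))
    (dual_coproduct T).
Proof.
etransitivity; first by apply/esym/hom2_left.
etransitivity; last exact: hom2_right.
rewrite (hom2_coproduct T (milnor0 y10 y20) y30).
rewrite (hom2_coproduct T y10 (milnor0 y20 y30)).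
apply: (congr1 (pairing f)); apply: eq_xipow => n _.
exact/milnorA/pchar_malg.
Qed.
End Coassoc.

Lemma coassoc f T :
  pairing (fun u => pairing (fun v => f (v.1, v.2, u.2)) (dual_coproduct u.1))
    (dual_coproduct T) =
  pairing (fun u => pairing (fun v => f (u.1, v.1, v.2)) (dual_coproduct u.2))
    (dual_coproduct T).
Proof.
pose y (g : nat -> expo * expo * expo) n : {malg 'F_2[(expo * expo * expo)%type]} :=
  if n is i.+1 then << g i >> else 1.
exact: (@coassoc_at (y (fun i => (ucm i, mone, mone)))
  (y (fun i => (mone, ucm i, mone))) (y (fun i => (mone, mone, ucm i)))).
Qed.

Fact steenrod_mulA : associative steenrod_mul.
Proof.
move=> a b c; apply: steenrodP => T.
rewrite (steenrod_mulE a (steenrod_mul b c)) (steenrod_mulE (steenrod_mul a b) c).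
pose f (u : expo * expo * expo) := (scoef a)@_u.1.1 * (scoef b)@_u.1.2 * (scoef c)@_u.2.
transitivity (pairing (fun u => pairing (fun v => f (u.1, v.1, v.2))
    (dual_coproduct u.2)) (dual_coproduct T)).
  apply: eq_pairing => u; rewrite (steenrod_mulE b c) pairing_mull.
  by apply: eq_pairing => v; rewrite /f mulrA.
etransitivity; first by apply/esym/coassoc.
apply: eq_pairing => u; rewrite (steenrod_mulE a b) pairing_mulr.
by apply: eq_pairing.
Qed.

Fact steenrod_mulDl : left_distributive steenrod_mul +%R.
Proof.
move=> a b c; apply: steenrodP => T; rewrite scoefD !steenrod_mulE -big_split /=.
by apply: eq_bigr => u _; rewrite scoefD -mulrDr -mulrDl.
Qed.

Fact steenrod_mulDr : right_distributive steenrod_mul +%R.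
Proof.
move=> a b c; apply: steenrodP => T; rewrite scoefD !steenrod_mulE -big_split /=.
by apply: eq_bigr => u _; rewrite scoefD -mulrDr -mulrDr.
Qed.

Section Counit.
Variables e z : nat -> {malg 'F_2[expo]}.
Hypotheses (eE : forall n, e n = (n == 0%N)%:R) (z0 : z 0%N = 1).
Hypothesis zS : forall i, z i.+1 = << ucm i >>.

Fact xipow_e R : xipow e R = (R == mone)%:R.
Proof.
elim/expo_ind: R => [|i R _]; first by rewrite xipow1 eqxx.
rewrite xipowM xipowU eE mul0r; case: eqP => // /unitm[/eqP/cmP/(_ i)].
by rewrite cmUU cm1.
Qed.

Fact xipow_z R : xipow z R = << R >>.
Proof. exact: (xipow_gen (f := id) _ _ zS). Qed.

Fact milnor_ez n : milnor e z n = z n.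
Proof.
rewrite /milnor big_nat_recr //= subnn eE expr1n mul1r big1_seq ?add0r //.
move=> i; rewrite mem_index_iota => /andP[_ /andP[_ lin]].
by rewrite eE subn_eq0 leqNgt lin expr0n expn_eq0 mul0r.
Qed.

Fact milnor_ze n : milnor z e n = z n.
Proof.
rewrite /milnor big_nat_recl //= subn0 expn0 expr1 eE mulr1 big1 ?addr0 //.
by move=> i _; rewrite eE mulr0.
Qed.

Fact hom2_ez f x : pairing f (hom2 e z x) =
  pairing (fun u => (u.1 == mone)%:R * f u.2) x.
Proof.
apply: (malg_F2_ext (f := pairing f \o hom2 e z)) => -[U Q] /=.
rewrite [RHS]pairingU mul1r hom2U /xipow2 /= xipow_e xipow_z.
by case: eqP => _; rewrite ?mul1r ?mul0r ?raddf0 // pairingU mul1r.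
Qed.

Fact hom2_ze f x : pairing f (hom2 z e x) =
  pairing (fun u => f u.1 * (u.2 == mone)%:R) x.
Proof.
apply: (malg_F2_ext (f := pairing f \o hom2 z e)) => -[U Q] /=.
rewrite [RHS]pairingU mul1r hom2U /xipow2 /= xipow_e xipow_z.
by case: eqP => _; rewrite ?mulr1 ?mulr0 ?raddf0 // pairingU mul1r.
Qed.

Fact counit_left f T :
  pairing (fun u => (u.1 == mone)%:R * f u.2) (dual_coproduct T) = f T.
Proof.
rewrite -hom2_ez hom2_coproduct ?eE //.
by rewrite (eq_xipow _ (fun n _ => milnor_ez n)) xipow_z pairingU mul1r.
Qed.

Fact counit_right f T :
  pairing (fun u => f u.1 * (u.2 == mone)%:R) (dual_coproduct T) = f T.
Proof.
rewrite -hom2_ze hom2_coproduct ?eE //.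
by rewrite (eq_xipow _ (fun n _ => milnor_ze n)) xipow_z pairingU mul1r.
Qed.
End Counit.

Section Unit.
Let e n : {malg 'F_2[expo]} := (n == 0%N)%:R.
Let z n : {malg 'F_2[expo]} := if n is i.+1 then << ucm i >> else 1.

Fact steenrod_mul1l : left_id (Sq mone) steenrod_mul.
Proof.
move=> a; apply: steenrodP => T; rewrite steenrod_mulE.
rewrite -[RHS](@counit_left e z _ _ _ (fun R => (scoef a)@_R)) //.
by apply: eq_pairing => u; rewrite mcoeffU eq_sym.
Qed.

Fact steenrod_mul1r : right_id (Sq mone) steenrod_mul.
Proof.
move=> a; apply: steenrodP => T; rewrite steenrod_mulE.
rewrite -[RHS](@counit_right e z _ _ _ (fun R => (scoef a)@_R)) //.
by apply: eq_pairing => u; rewrite mcoeffU eq_sym.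
Qed.

End Unit.

Fact steenrod_1neq0 : Sq mone != 0.
Proof. by apply/eqP => /(congr1 scoef)/eqP; rewrite monalgU_eq0 oner_eq0. Qed.

HB.instance Definition _ := GRing.Zmodule_isNzRing.Build steenrod
  steenrod_mulA steenrod_mul1l steenrod_mul1r
  steenrod_mulDl steenrod_mulDr steenrod_1neq0.

Lemma mcoeff_steenrodM (a b : steenrod) T : (scoef (a * b))@_T =
  pairing (fun u => (scoef a)@_u.1 * (scoef b)@_u.2) (dual_coproduct T).
Proof. exact: steenrod_mulE. Qed.

Fact steenrod_scaleAl (c : 'F_2) (a b : steenrod) : c *: (a * b) = c *: a * b.
Proof.
apply: steenrodP => T; rewrite scoefZ mcoeff_steenrodM (mcoeff_steenrodM (c *: a)) pairing_mull.
by apply: eq_pairing => u; rewrite scoefZ mulrA.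
Qed.
HB.instance Definition _ :=
  GRing.Lmodule_isLalgebra.Build 'F_2 steenrod steenrod_scaleAl.

Fact steenrod_scaleAr (c : 'F_2) (a b : steenrod) : c *: (a * b) = a * (c *: b).
Proof.
apply: steenrodP => T; rewrite scoefZ mcoeff_steenrodM (mcoeff_steenrodM a) pairing_mull.
by apply: eq_pairing => u; rewrite scoefZ mulrCA.
Qed.
HB.instance Definition _ :=
  GRing.Lalgebra_isAlgebra.Build 'F_2 steenrod steenrod_scaleAr.

(* [mone] is the exponent sequence (0, 0, ...). *)
Fact Sq_one : Sq mone = 1. Proof. by []. Qed.

Section SubHopf.
Variable B : steenrod -> Prop.

(* The Milnor coproduct is dual to the multiplication of monomials, so the
   coefficient of Sq(R) (x) Sq(S) in the coproduct of [b] is the coefficient of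
   Sq(R + S) in [b]; the last clause says that the coproduct of [b] is a sum of
   tensors [u (x) v] with [u, v] in [B].  Closure under the antipode is
   automatic, the algebra being graded and connected and [B] (which below has
   a basis of elements Sq(R)) a graded sub-bialgebra. *)
Definition sub_hopf : Prop :=
  [/\ B 1,
      forall (c : 'F_2) a b, B a -> B b -> B (c *: a + b),
      forall a b, B a -> B b -> B (a * b) &
      forall b, B b -> exists l : seq (steenrod * steenrod),
        (forall u, u \in l -> B u.1 /\ B u.2) /\
        forall R S, (scoef b)@_(mmul R S) =
          \sum_(u <- l) (scoef u.1)@_R * (scoef u.2)@_S].

Definition in_profile (p : nat -> nat) (R : expo) : Prop :=
  forall j, (0 < j)%N -> (rr R j < 2 ^ p j)%N.

Definition has_profile (p : nat -> nat) : Prop :=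
  forall b, B b <-> (forall R, (scoef b)@_R != 0 -> in_profile p R).

Definition admissible (p : nat -> nat) : Prop :=
  [/\ sub_hopf,
      exists l : seq steenrod, forall b, B b -> b \in l,
      has_profile p &
      forall i j, (0 < i)%N -> (0 < j)%N -> (p i - j <= p (i + j))%N].
End SubHopf.

(* F(n), spanned by the Sq(R) with r_1 = ... = r_n = 0. *)
Definition Fsub (n : nat) (a : steenrod) : Prop :=
  forall R, (scoef a)@_R != 0 -> forall j, (0 < j <= n)%N -> rr R j = 0%N.

Section Signatures.
Variable p : nat -> nat.

Definition sig (S : expo) : expo :=
  [cmonom S i %% 2 ^ p i.+1 | i in finsupp S]%M.

Lemma sigE S i : sig S i = (S i %% 2 ^ p i.+1)%N.
Proof. by rewrite /sig cmE fsfun_fun; case: finsuppP; rewrite ?mod0n. Qed.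

Lemma sigP S R :
  (in_profile p R /\
    forall j, (0 < j)%N -> rr S j = rr R j %[mod 2 ^ p j]) <-> sig S = R.
Proof.
split=> [[pR SR]|<-].
  apply/eqP/cmP => i; rewrite sigE; have /= -> := SR i.+1 isT.
  by rewrite modn_small //; apply: (pR i.+1).
split=> -[|i] // _; rewrite /rr /= sigE ?modn_mod //.
by rewrite ltn_mod expn_gt0.
Qed.
End Signatures.

(* P_t^s, for t >= 1. *)
Definition Pts (t s : nat) : steenrod :=
  Sq [cmonom 2 ^ s | _ in fset1 t.-1]%M.

(* [Ps] lists the pairs (t, s) with P_t^s in [B] in decreasing order, for some
   order with P_t^s < P_t'^s' whenever t < t'; the relative order of the P_t^s
   with the same t is left free. *)
Definition Pts_enum (B : steenrod -> Prop) (Ps : seq (nat * nat)) : Prop :=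
  [/\ uniq Ps,
      forall t s, (t, s) \in Ps <-> (0 < t)%N /\ B (Pts t s) &
      sorted (fun u v => v.1 <= u.1)%N Ps].

(* The binary digits eps_k of the exponents: r_j = sum_(t_k = j) 2^(s_k) eps_k. *)
Definition digits (Ps : seq (nat * nat)) (R : expo) : seqlexi bool :=
  [seq odd (rr R u.1 %/ 2 ^ u.2) | u <- Ps].

Definition sig_lt (Ps : seq (nat * nat)) : rel expo :=
  fun R S => (digits Ps R < digits Ps S)%O.

(* The free left module on [G] has the F_2-basis Sq(S) g; [supported P x] says
   that [x] is in the span of the basis elements satisfying [P]. *)
Definition supported (G : choiceType) (P : expo -> G -> Prop)
    (x : {malg steenrod[G]}) : Prop :=
  forall S g, (scoef x@_g)@_S != 0 -> P S g.

Definition homog (G : choiceType) (deg : G -> nat) (q : nat) :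
    {malg steenrod[G]} -> Prop :=
  supported (fun S g => sqdeg S + deg g = q)%N.

(* [bd p] is the differential from C_p to C_(p-1); as [0.-1 = 0], the
   convention C_(-1) = 0 is expressed by [bd 0 = 0]. *)
Record free_complex := FreeComplex {
  gen : nat -> choiceType;
  gdeg : forall p, gen p -> nat;
  bd : forall p, {linear {malg steenrod[gen p]} -> {malg steenrod[gen p.-1]}};
  gen_finite : forall p q, exists l : seq (gen p),
    forall g, gdeg g = q -> g \in l;
  bd_homog : forall p q x, homog (@gdeg p) q x -> homog (@gdeg p.-1) q (bd p x);
  bd_bottom : forall x, bd 0 x = 0;
  bd_bd : forall p x, bd p.-1 (bd p x) = 0
}.

Notation cx C p := {malg steenrod[gen C p]}.

Section Homology.
Variable C : free_complex.

Definition in_deg p q (x : cx C p) : Prop := homog (@gdeg C p) q x.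

Definition cycle p q (x : cx C p) : Prop := in_deg q x /\ bd C p x = 0.

Definition boundary p q (x : cx C p) : Prop :=
  exists2 y : cx C p.+1, in_deg q y & bd C p.+1 y = x.

Definition homology_zero p q : Prop :=
  forall x : cx C p, cycle q x -> boundary q x.

Definition homology_dim1 p q : Prop :=
  exists z : cx C p, [/\ cycle q z, ~ boundary q z &
    forall x, cycle q x -> exists c : 'F_2, boundary q (x - c%:A *: z)].

Definition partial_resolution (s t : nat) : Prop :=
  (forall p q, (p < s)%N \/ (q < t)%N -> (p, q) <> (0%N, 0%N) ->
     homology_zero p q) /\
  ((0 < s)%N \/ (0 < t)%N -> homology_dim1 0 0).
End Homology.

Section Filtration.
Variables (prof : nat -> nat) (Ps : seq (nat * nat)) (C : free_complex).

(* F_S C = F_S A (x)_A C is spanned by the Sq(T) g with sig(T) >= S, so [inFgt R]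
   describes the sum of the F_S C over S > R. *)
Definition inE R p (x : cx C p) : Prop :=
  supported (fun S _ => sig prof S = R) x.

Definition inFgt R p (x : cx C p) : Prop :=
  supported (fun S _ => sig_lt Ps R (sig prof S)) x.

Definition Ecomp R p (x : cx C p) : cx C p :=
  \sum_(g <- msupp x) << Steenrod
    (\sum_(S <- msupp (scoef x@_g) | sig prof S == R)
       << (scoef x@_g)@_S *g S >>) *g g >>.

(* [y] is the image of [x] in E_R C under the differential induced on the
   quotient of F_R C by the sum of the F_S C with S > R. *)
Definition Ediff R p (x : cx C p) (y : cx C p.-1) : Prop :=
  inE R y /\ inFgt R (bd C p x - y).

Variables s t : nat.

Definition E0_cycle (y : cx C s) : Prop :=
  [/\ inE mone y, in_deg t y & Ediff mone y 0].

Definition E0_boundary (y : cx C s) : Prop :=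
  exists z : cx C s.+1, [/\ inE mone z, in_deg t z & Ediff mone z y].

(* Steps (1) and (2): the [x i] represent a basis of H(E_0 C)_(s,t). *)
Definition E0_homology_basis m (x : 'I_m -> cx C s) : Prop :=
  [/\ forall i, E0_cycle (x i),
      forall c : 'I_m -> 'F_2,
        E0_boundary (\sum_i (c i)%:A *: x i) -> forall i, c i = 0 &
      forall y, E0_cycle y -> exists c : 'I_m -> 'F_2,
        E0_boundary (y - \sum_i (c i)%:A *: x i)].

(* [f] is a solution of M . f = e, with M the matrix of
   d : E_R C_(s,t) -> E_R C_(s-1,t). *)
Definition solves R (e : cx C s.-1) (f : cx C s) : Prop :=
  [/\ inE R f, in_deg t f & Ediff R f e].

(* Step (3): [signature_run x0 Rs x d] holds if, starting from [x0] and
   treating the signatures [Rs] in this order, some choice of solutions leads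
   to the current values [x] and [d] of the x_i and d_i. *)
Inductive signature_run m (x0 : 'I_m -> cx C s) :
  seq expo -> ('I_m -> cx C s) -> ('I_m -> cx C s.-1) -> Prop :=
| run_start : signature_run x0 [::] x0 (fun i => bd C s (x0 i))
| run_step Rs R x d f : signature_run x0 Rs x d ->
    (forall i, solves R (Ecomp R (d i)) (f i)) ->
    signature_run x0 (rcons Rs R) (fun i => x i - f i)
      (fun i => d i - bd C s (f i)).
End Filtration.

Definition signature_enum (B : steenrod -> Prop) (Ps : seq (nat * nat))
    (sigs : seq expo) : Prop :=
  sorted (sig_lt Ps) sigs /\
  forall R, R \in sigs <-> B (Sq R) /\ R <> mone.

Definition push (G H : choiceType) (f : G -> H) (x : {malg steenrod[G]}) :
    {malg steenrod[H]} :=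
  \sum_(g <- msupp x) << x@_g *g f g >>.

(* [C'] is [C] with new free generators [g i] in bidegree (s+1, t) and
   differential d (g i) = x i. *)
Definition adjoins (C : free_complex) (s t m : nat) (x : 'I_m -> cx C s)
    (C' : free_complex) : Prop :=
  exists (f : forall p, gen C p -> gen C' p) (g : 'I_m -> gen C' s.+1),
  [/\ [/\ forall p, injective (f p), injective g & forall a i, f s.+1 a <> g i],
      (forall p, p <> s.+1 -> forall b, exists a, b = f p a) /\
        (forall b, (exists a, b = f s.+1 a) \/ (exists i, b = g i)),
      (forall p a, gdeg (f p a) = gdeg a) /\ (forall i, gdeg (g i) = t),
      forall p a, bd C' p << f p a >> = push (f p.-1) (bd C p << a >>) &
      forall i, bd C' s.+1 << g i >> = push (f s) (x i)].

(* Main.v *)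
Require Import Defs.
From HB Require Import structures.
From mathcomp Require Import all_boot all_order all_algebra.
From mathcomp Require Import finmap.
From mathcomp.multinomials Require Import monalg.
From mathcomp Require Import zify.

Set Implicit Arguments.
Unset Strict Implicit.
Unset Printing Implicit Defensive.

Import GRing.Theory.
Local Open Scope ring_scope.

(** Let [N = 2^(n+1) - 1].  Since [B] lies in [F(n)], every signature [R <> 0]
has degree at least [N].

The engine is the vanishing of [H(E_0 C)_(k,q)] for [q < t] and [q < N k]
([E0_vanishing]).  In terms of homological algebra, [E_0 C = F_2 (x)_B C]
computes [Tor^B(F_2, F_2)] in degrees below [t], and in homological degree [k]
the bar complex of [B] lives in internal degrees [>= N k].  The proof is a
direct induction on [q] along the short exact sequence
[0 -> F_(>0) C -> C -> E_0 C -> 0].  A cycle [e] of [E_0 C_(k,q)] has its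
boundary in [F_(>0) C_(k-1,q)].  The pieces of [F_(>0) C] are the [E_R C] with
[R <> 0], and [H(E_R C)_(k-1,q)] is [H(E_0 C)_(k-1,q-|R|)], which vanishes by
induction because [q - |R| < N (k-1)].  Hence [d e = d f] for some [f] in
[F_(>0) C] ([cycle_is_boundary]); the cycle [e - f] bounds some [y] in [C], and
the component of [y] in [E_0 C] shows that [e] bounds in [E_0 C].

The correctness of the algorithm is the same argument once more.  Each system
[M f_i = e_i] with signature [R <> 0] is solvable because [e_i] is a cycle of
[E_R C_(s-1,t)] and [H(E_R C)_(s-1,t) = H(E_0 C)_(s-1,t-|R|) = 0]
([run_solvable]).  After all signatures have been treated, nothing is left of
[d_i], so that [x_i] is a cycle.  A cycle [y] of [C_(s,t)] is modulo
[F_(>0) C] a combination of the [x_i] and a boundary, and the remaining cycle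
in [F_(>0) C_(s,t)] bounds since all [H(E_R C)_(s,t)] vanish
([run_generates]).

What the Steenrod algebra contributes is the isomorphism of [E_R C] with the
shifted complex [E_0 C] ([E_homology_shift]): left multiplication by [Sq(R)]
carries [F_(>0) C] into [F_(>R) C] and detects it ([scale_inFgt]).  This rests
on two facts about the coefficient of [xi^R (x) xi^S] in [Delta xi^T].  If it
is nonzero then [sig R <= sig T] ([coproduct_sig_le]), and for [R = sig T] it
is 1 if [T = R + S] and 0 otherwise ([coproduct_sig]).  Both are read off from
the binary digits of the exponents: a digit 1 of [T_n] in position [s] stands
for a factor [xi_n^(2^s)], and [Delta xi^T] is the sum over all ways to choose,
for each of these factors, a summand [xi_(n-i)^(2^(i+s)) (x) xi_i^(2^s)] of its
coproduct. *)

(** * Binary digits *)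

Definition bit (n k : nat) : bool := odd (n %/ 2 ^ k).

Lemma bit_muladd q a K k : (k < q)%N -> bit (a + 2 ^ q * K) k = bit a k.
Proof.
move=> kq; rewrite /bit -(subnK (ltnW kq)) expnD -mulnA [(_ * (2 ^ k * _))%N]mulnCA.
rewrite [(a + _)%N]addnC mulnC divnMDl ?expn_gt0 // oddD oddM oddX.
by rewrite subn_eq0 leqNgt kq.
Qed.

Lemma bitS n k : bit n k.+1 = bit n./2 k.
Proof. by rewrite /bit expnS divnMA divn2. Qed.

Lemma bit0 n : bit n 0 = odd n.
Proof. by rewrite /bit expn0 divn1. Qed.

Lemma bits_inj m n : bit m =1 bit n -> m = n.
Proof.
move: {2}(maxn m n) (leqnn (maxn m n)) => k.
elim: k m n => [|k IH] m n; first by rewrite geq_max !leqn0 => /andP[/eqP-> /eqP->].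
move=> le mn; rewrite -(odd_double_half m) -(odd_double_half n) -!bit0 mn.
congr (_ + _.*2)%N.
case: (posnP (maxn m n)) => [|pos].
  by move/eqP; rewrite -leqn0 geq_max !leqn0 => /andP[/eqP-> /eqP->].
apply: IH => [|j]; last by rewrite -!bitS mn.
by rewrite -ltnS (leq_trans _ le) //; lia.
Qed.

Lemma bit_sum d (b : nat -> bool) k :
  bit (\sum_(s < d | b s) 2 ^ s) k = (k < d)%N && b k.
Proof.
elim: d b k => [|d IH] b k; first by rewrite big_ord0 /bit div0n.
rewrite big_mkcond big_ord_recl /=.
have -> : (\sum_(i < d) (if b (bump 0 i) then 2 ^ bump 0 i else 0) =
  (\sum_(s < d | b s.+1) 2 ^ s).*2)%N.
  by rewrite -muln2 big_distrl /= [RHS]big_mkcond /=; apply: eq_bigr => i _;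
    rewrite /bump /= add1n expnS mulnC.
case: k => [|k]; first by rewrite bit0 oddD odd_double /=; case: (b 0%N).
rewrite bitS ltnS -[RHS](IH (fun s => b s.+1)); congr bit.
by case: (b 0%N); rewrite ?expn0 /=; lia.
Qed.

Lemma bit_mod n q k : bit (n %% 2 ^ q) k = (k < q)%N && bit n k.
Proof.
case: ltnP => [kq|qk].
  by rewrite [in RHS](divn_eq n (2 ^ q)) addnC mulnC bit_muladd.
rewrite /bit divn_small // (@leq_trans (2 ^ q)%N) ?leq_exp2l //.
by rewrite ltn_mod expn_gt0.
Qed.

Lemma sum_bits n d : (n < 2 ^ d)%N -> n = (\sum_(s < d | bit n s) 2 ^ s)%N.
Proof.
move=> nd; apply: bits_inj => k; rewrite bit_sum.
by rewrite -[in LHS](modn_small nd) bit_mod.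
Qed.

(** * The coproduct as a sum over choices, one for each binary digit *)

(** The exponent sequence of a power of a single generator; it is locked since
conversion may otherwise unfold it when it is compared with [ucm] or [mone]. *)
HB.lock Definition upow (m k : nat) : expo := [cmonom k | _ in fset1 m]%M.

Lemma upowE m k j : upow m k j = if m == j then k else 0%N.
Proof. by rewrite upow.unlock cmE fsfun_fun in_fset1 eq_sym. Qed.

Lemma upow_add m k l : mmul (upow m k) (upow m l) = upow m (k + l).
Proof. by apply/eqP/cmP => j; rewrite cmM !upowE; case: eqP. Qed.

Lemma upow0 m : upow m 0 = mone.
Proof. by apply/eqP/cmP => j; rewrite cm1 upowE; case: eqP. Qed.

Lemma ucm_upow m k : mmul (ucm m) (upow m k) = upow m k.+1.
Proof. by rewrite -[k.+1]add1n -upow_add upow.unlock. Qed.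

(** The exponents of the summand [xi_(n+1-i)^(2^(i+s)) (x) xi_i^(2^s)] of the
coproduct of [xi_(n+1)^(2^s)], where [x = (n, s)]. *)
Definition left_factor (x : nat * nat) (i : nat) : expo :=
  if (i <= x.1)%N then upow (x.1 - i) (2 ^ (i + x.2)) else mone.
Definition right_factor (x : nat * nat) (i : nat) : expo :=
  if i is j.+1 then upow j (2 ^ x.2) else mone.

(** A name of its own, made opaque below, for [<< (R, S) >>], whose several
convertible canonical structures are expensive to compare. *)
Definition mono2 (R S : expo) : dual2 := << (R, S) >>.

Lemma mono2_1 : 1 = mono2 mone mone.
Proof. by []. Qed.

Lemma mono2M R S R' S' :
  mono2 R S * mono2 R' S' = mono2 (mmul R R') (mmul S S').
Proof. exact: malgUU. Qed.

Lemma mcoeff_mono2 R S u : (mono2 R S)@_u = (u == (R, S))%:R.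
Proof. by rewrite mcoeffU1 eq_sym. Qed.

Lemma xi_leftE m : xi_left m.+1 = mono2 (ucm m) mone.
Proof. by []. Qed.

Lemma xi_rightE m : xi_right m.+1 = mono2 mone (ucm m).
Proof. by []. Qed.

Opaque mono2.

Lemma xi_left_pow m k : xi_left m.+1 ^+ k = mono2 (upow m k) mone.
Proof.
elim: k => [|k IH]; first by rewrite expr0 upow0 mono2_1.
rewrite exprS IH xi_leftE mono2M ucm_upow mul1m; reflexivity.
Qed.

Lemma xi_right_pow m k : xi_right m.+1 ^+ k = mono2 mone (upow m k).
Proof.
elim: k => [|k IH]; first by rewrite expr0 upow0 mono2_1.
rewrite exprS IH xi_rightE mono2M ucm_upow mul1m; reflexivity.
Qed.

Lemma xi_term_pow (x : nat * nat) i : (i <= x.1.+1)%N ->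
  (xi_left (x.1.+1 - i) ^+ (2 ^ i) * xi_right i) ^+ (2 ^ x.2) =
  mono2 (left_factor x i) (right_factor x i).
Proof.
case: x => n s; rewrite /left_factor /right_factor => lei.
have H : (xi_left (n.+1 - i) ^+ (2 ^ i)) ^+ (2 ^ s) =
  mono2 (if (i <= n)%N then upow (n - i) (2 ^ (i + s)) else mone) mone.
  case: leqP => [lin|nli]; first by rewrite subSn // -exprM -expnD xi_left_pow.
  have /eqP-> : (n.+1 - i == 0)%N by rewrite subn_eq0.
  by rewrite [xi_left 0]/= !expr1n mono2_1.
rewrite exprMn_comm; last exact: mulrC.
rewrite H; case: i lei {H} => [|i] _; first by rewrite expr1n mulr1.
rewrite xi_right_pow mono2M mulm1 mul1m; reflexivity.
Qed.

(** In this section [2^d] bounds all exponents of [T], and [d] bounds the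
indices where they are nonzero, so that the digits of [T] are indexed by a
finite type. *)
Section Expansion.
Variables (T : expo) (d : nat).
Hypotheses (Td : forall i, (T i < 2 ^ d)%N) (T0 : forall i, (d <= i)%N -> T i = 0%N).

Let I := ('I_d * 'I_d)%type.
Let pt (x : I) : nat * nat := (val x.1, val x.2).
Definition is_digit (x : I) : bool := bit (T x.1) x.2.

Definition summands (x : I) : pred 'I_d.+1 := fun i => (i <= x.1.+1)%N.

Definition left_mon (f : {ffun I -> 'I_d.+1}) : expo :=
  \big[mmul/mone]_(x | is_digit x) left_factor (pt x) (f x).
Definition right_mon (f : {ffun I -> 'I_d.+1}) : expo :=
  \big[mmul/mone]_(x | is_digit x) right_factor (pt x) (f x).

Lemma xipow_digits (K : comNzRingType) (a : nat -> K) :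
  xipow a T = \prod_(x : I | is_digit x) a x.1.+1 ^+ (2 ^ x.2).
Proof.
have sT : (finsupp T `<=` [fset i in iota 0 d])%fset.
  apply/fsubsetP => i; rewrite -cmE_neq0 inE /= mem_iota add0n /=.
  by apply: contraR; rewrite -leqNgt => /T0->.
rewrite (xipowEw a sT) (perm_big (iota 0 d)) /=; last first.
  by apply: uniq_perm; rewrite ?fset_uniq ?iota_uniq // => i; rewrite inE.
rewrite -[d in iota 0 d]subn0 big_mkord.
rewrite [RHS]big_mkcond /= -(pair_bigA _ (fun i j : 'I_d =>
  if is_digit (i, j) then a i.+1 ^+ (2 ^ j) else 1)) /=.
apply: eq_bigr => i _.
by rewrite -big_mkcond /= {1}(sum_bits (Td i)) expr_sum.
Qed.

Lemma pow2_sum (J : finType) (P : pred J) (F : J -> dual2) k :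
  (\sum_(j | P j) F j) ^+ (2 ^ k) = \sum_(j | P j) F j ^+ (2 ^ k).
Proof.
apply: (big_morph (fun x : dual2 => x ^+ (2 ^ k))) => [x y|].
  by rewrite exprDn_pchar // pnatX (eq_pnat _ (pcharf_eq (pchar_malg _))) pnat_id.
by rewrite expr0n expn_eq0.
Qed.

(** Squaring is additive, so each factor [xi_n^(2^s)] of [xi^T] has a coproduct
with as many summands as that of [xi_n]; the product over the digits is then
expanded by distributivity. *)
Lemma coproduct_choices :
  dual_coproduct T = \sum_(f in pfamily ord0 is_digit summands)
    mono2 (left_mon f) (right_mon f).
Proof.
rewrite dual_coproduct.unlock xipow_digits.
transitivity (\prod_(x : I | is_digit x)
    \sum_(i | summands x i)
      mono2 (left_factor (pt x) i) (right_factor (pt x) i)).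
  apply: eq_bigr => x _; rewrite /milnor.
  rewrite (big_nat_widen _ _ d.+1) ?ltnS //.
  rewrite big_mkord pow2_sum; apply: eq_bigr => i ci.
  by rewrite (xi_term_pow (x := pt x)).
rewrite (big_distr_big_dep ord0); apply: eq_bigr => f _.
rewrite /left_mon /right_mon; elim/big_rec3: _ => [|x R S y _ ->]; first exact: mono2_1.
exact: mono2M.
Qed.

Lemma left_monE f m : left_mon f m =
  (\sum_(x | is_digit x && ((f x <= x.1)%N && (x.1 - f x == m)%N)) 2 ^ (f x + x.2))%N.
Proof.
rewrite /left_mon (big_morph (fun R : expo => R m) (id1 := 0%N) (op1 := addn)); first last.
- exact: cm1.
- by move=> R S; apply: cmM.
rewrite [LHS]big_mkcond [RHS]big_mkcond; apply: eq_bigr => x _.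
case: is_digit => //=; rewrite /left_factor /pt /=.
by case: leqP => _; rewrite ?cm1 ?upowE.
Qed.

Lemma right_monE f m : right_mon f m =
  (\sum_(x | is_digit x && (f x == m.+1 :> nat)) 2 ^ x.2)%N.
Proof.
rewrite /right_mon (big_morph (fun R : expo => R m) (id1 := 0%N) (op1 := addn)); first last.
- exact: cm1.
- by move=> R S; apply: cmM.
rewrite [LHS]big_mkcond [RHS]big_mkcond; apply: eq_bigr => x _.
case: is_digit => //=; rewrite /right_factor /pt /=.
by case: (val (f x)) => [|i]; rewrite ?cm1 ?upowE.
Qed.

(** Only two kinds of digits contribute to row [m] of the left exponent: those
of the same row of [T] whose choice is 0, each with its own position, and
those of higher rows, which are moved up by [f x] positions.  When the latter
land in positions [>= q], the digits below [q] are those of the former.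
Positions [>= d] carry no digits, whence the value [false]. *)
Lemma left_mon_bits (f : {ffun I -> 'I_d.+1}) (m : 'I_d) q k :
  (forall x, is_digit x -> (0 < f x)%N -> (f x <= x.1)%N -> (x.1 - f x = m)%N ->
     (q <= f x + x.2)%N) ->
  (k < q)%N ->
  bit (left_mon f m) k =
    bit (T m) k && (if insub k is Some s then f (m, s) == ord0 else false).
Proof.
move=> high kq; rewrite left_monE (bigID (fun x => f x == ord0)) /=.
pose b k := bit (T m) k && (if insub k is Some s then f (m, s) == ord0 else false).
rewrite (_ : (\sum_(x | _ && (f x == ord0)) _ = \sum_(s < d | b s) 2 ^ s)%N); last first.
  rewrite (eq_bigl (fun x => is_digit x && (f x == ord0) && (x.1 == m))); last first.
    move=> x; case: is_digit; rewrite //= andbC; case: eqP => //= ->.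
    by rewrite /= subn0.
  rewrite (reindex_onto (fun s => (m, s)) snd) /=; last first.
    by case=> i s /= /andP[_ /eqP->].
  rewrite /b; apply: eq_big => [s|s /andP[/andP[/andP[_ /eqP->] _] _]] //=.
  by rewrite !eqxx !andbT valK.
have /dvdnP[K ->] : (2 ^ q %| \sum_(x | is_digit x &&
    ((f x <= x.1)%N && (x.1 - f x == m)%N) && (f x != ord0)) 2 ^ (f x + x.2))%N.
  apply: dvdn_sum => x /andP[/andP[Dx /andP[fx /eqP xm]] f0].
  by apply: dvdn_exp2l; apply: high; rewrite // lt0n.
rewrite mulnC bit_muladd // bit_sum /b.
by case: ltnP => // dk; rewrite insubN ?andbF // -leqNgt.
Qed.

Lemma bit_small k : (d <= k)%N -> forall m, bit (T m) k = false.
Proof.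
by move=> dk m; rewrite -[T m](modn_small (Td m)) bit_mod ltnNge dk.
Qed.

Variable p : nat -> nat.
Hypothesis p_adm :
  forall i j, (0 < i)%N -> (0 < j)%N -> (p i - j <= p (i + j))%N.

(** [R] and [T] have the same digits in the positions seen by the profile, in
the rows [>= m]. *)
Definition rows_agree (m : nat) (R : expo) :=
  forall n k, (m <= n)%N -> (k < p n.+1)%N -> bit (R n) k = bit (T n) k.

(** In the rows [>= m] all digits seen by the profile choose the summand
[xi_n^(2^s) (x) 1]. *)
Definition left_from (m : nat) (f : {ffun I -> 'I_d.+1}) :=
  forall x, is_digit x -> (m <= x.1)%N -> (x.2 < p x.1.+1)%N -> f x = ord0.

(** Admissibility enters here.  A digit of a row [n > m] which moves to row [m]
has [i = n - m > 0], hence a position [>= p n] by [left_from]; it lands in a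
position [>= p n + (n - m) >= p m], out of sight of the profile. *)
Lemma left_mon_bits_left_from f (m : 'I_d) k : left_from m.+1 f ->
  (k < p m.+1)%N -> bit (left_mon f m) k =
    bit (T m) k && (if insub k is Some s then f (m, s) == ord0 else false).
Proof.
move=> un; apply: left_mon_bits => x Dx f0 fx xm.
have mx : (m < x.1)%N by rewrite -xm; lia.
have : (p x.1.+1 <= x.2)%N.
  by rewrite leqNgt; apply/negP => /(un _ Dx mx) fx0; rewrite fx0 in f0.
have := @p_adm m.+1 (f x) isT f0.
have -> : (m.+1 + f x = x.1.+1)%N by rewrite -xm; lia.
lia.
Qed.

(** Downward induction on the row: once the rows above choose [i = 0], the
digits of the left exponent in this row are exactly the digits of [T] which
choose [i = 0], so agreement forces all of them to do so. *)
Lemma rows_agree_left_from f m : rows_agree m (left_mon f) -> left_from m f.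
Proof.
move=> agr x; move: {2}(d - x.1)%N (leqnn (d - x.1)) => e.
elim: e x => [|e IH] [i s] /= le Di mi sp.
  by move: le; rewrite leqn0 subn_eq0 leqNgt ltn_ord.
have un : left_from i.+1 f.
  move=> [j u] Dj /= ij up; apply: (IH (j, u)) => //=; last by lia.
  by move: le ij (ltn_ord j) (ltn_ord i); lia.
have := agr i s mi sp; rewrite (left_mon_bits_left_from un sp) valK.
by move: Di; rewrite /is_digit /= => -> /= /eqP.
Qed.

Lemma left_mon_big f m : (d <= m)%N -> left_mon f m = 0%N.
Proof.
move=> dm; rewrite left_monE big1 // => x /andP[_ /andP[_ /eqP]].
by move: (ltn_ord x.1); lia.
Qed.

Lemma left_mon_dominated f m k : rows_agree m.+1 (left_mon f) -> (k < p m.+1)%N ->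
  bit (left_mon f m) k -> bit (T m) k.
Proof.
move=> agr kp; case: (ltnP m d) => [md|dm].
  rewrite -[m]/(val (Ordinal md)) left_mon_bits_left_from //; first by case/andP.
  exact: rows_agree_left_from.
by rewrite left_mon_big // /bit div0n.
Qed.

(** The only choice whose left exponent is the signature of [T]: digits seen by
the profile go to the left factor, all others to the right factor. *)
Definition cut_choice : {ffun I -> 'I_d.+1} :=
  [ffun x => if is_digit x && (p x.1.+1 <= x.2)%N then inord x.1.+1 else ord0].

Lemma cut_choice_in : cut_choice \in pfamily ord0 is_digit summands.
Proof.
apply/pfamilyP; split.
  by apply/supportP => x /negPf Dx; rewrite ffunE [is_digit x]Dx.
move=> x Dx; rewrite unfold_in ffunE [is_digit x]Dx /=; case: ifP => //= _.
by rewrite inordK // ltnS.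
Qed.

(** A digit in a position [s >= p n] that contributed to the left factor would
contribute [2^(i+s)] with [i + s >= p (n - i)], more than a reduced exponent
can hold. *)
Lemma cut_choice_uniq f : f \in pfamily ord0 is_digit summands ->
  left_mon f = sig p T -> f = cut_choice.
Proof.
move=> /pfamilyP[/supportP f0 fQ] fT; apply/ffunP => x; rewrite ffunE.
have agr : rows_agree 0 (left_mon f).
  by move=> n k _ kp; rewrite fT sigE bit_mod kp.
case: (boolP (is_digit x)) => [Dx|/f0 //] /=.
case: ltnP => [xp|px]; first exact: (rows_agree_left_from agr).
apply: val_inj; rewrite /= inordK ?ltnS //.
apply/eqP; rewrite eqn_leq; have -> /= : (f x <= x.1.+1)%N by apply: fQ.
rewrite ltnNge; apply/negP => fx.
have : (2 ^ (f x + x.2) <= left_mon f (x.1 - f x))%N.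
  rewrite left_monE (bigD1 x) /= ?leq_addr //.
  by rewrite Dx fx eqxx.
rewrite fT sigE; apply/negP; rewrite -ltnNge.
apply: leq_trans (ltn_pmod _ _) _; first by rewrite expn_gt0.
rewrite leq_exp2l //.
case: (posnP (f x)) => [fx0|fpos]; first by rewrite fx0 subn0.
have := @p_adm (x.1 - f x).+1 (f x) isT fpos.
rewrite addSn subnK // => pp.
by rewrite (leq_trans _ (leq_add (leqnn (f x)) px)) // -leq_subLR.
Qed.

Lemma left_mon_cut_choice : left_mon cut_choice = sig p T.
Proof.
apply/eqP/cmP => m; apply: bits_inj => k; rewrite sigE bit_mod.
case: (ltnP m d) => [md|dm]; last by rewrite left_mon_big // T0 // /bit div0n andbF.
rewrite -[m]/(val (Ordinal md)) (@left_mon_bits _ _ k.+1) //; last first.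
  move=> x Dx; rewrite ffunE Dx /=; case: ifP => //= _.
  by rewrite inordK ?ltnS // ltnn.
case: insubP => [s _ <-|]; last first.
  by rewrite -leqNgt => dk; rewrite !bit_small // !andbF.
rewrite ffunE /= /is_digit /=; case: bit; rewrite ?andbF //= andbT.
case: leqP => //= _; apply/eqP => /(congr1 val) /=.
by rewrite inordK.
Qed.

Lemma cut_choice_mul : mmul (left_mon cut_choice) (right_mon cut_choice) = T.
Proof.
apply/eqP/cmP => m; rewrite cmM left_mon_cut_choice sigE.
case: (ltnP m d) => [md|dm]; last first.
  rewrite T0 // mod0n right_monE big1 // => x /andP[_]; rewrite ffunE.
  case: ifP => //= _; rewrite inordK ?ltnS // => /eqP[xm].
  by move: (ltn_ord x.1); rewrite xm ltnNge dm.
have -> : right_mon cut_choice m = (\sum_(s < d | bit (T m) s && (p m.+1 <= s)) 2 ^ s)%N.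
  rewrite right_monE (reindex_onto (fun s => (Ordinal md, s)) snd) /=; last first.
    case=> i s /= /andP[Ds]; rewrite ffunE Ds /=; case: ifP => //= _.
    by rewrite inordK ?ltnS // => /eqP[im]; congr pair; apply: val_inj.
  apply: eq_bigl => s; rewrite ffunE eqxx andbT /is_digit /=.
  by case: bit => //=; case: leqP => //= _; rewrite inordK ?eqxx.
rewrite [RHS](sum_bits (Td m)) [RHS](bigID (fun s : 'I_d => (s < p m.+1)%N)) /=.
congr (_ + _)%N; last by apply: eq_bigl => s; rewrite -leqNgt.
apply: bits_inj => k; rewrite bit_mod.
rewrite (bit_sum _ (fun s => bit (T m) s && (s < p m.+1)%N)).
case: (ltnP k d) => [kd|dk]; first by rewrite andbC.
by rewrite bit_small // andbF.
Qed.
End Expansion.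

Lemma expo_bounded (T : expo) : exists d,
  (forall i, (T i < 2 ^ d)%N) /\ (forall i, (d <= i)%N -> T i = 0%N).
Proof.
exists (\sum_(i <- finsupp T) (T i + i.+1))%N.
have le i : i \in finsupp T -> (T i + i.+1 <= \sum_(j <- finsupp T) (T j + j.+1))%N.
  by move=> iT; rewrite (big_fsetD1 i) //= leq_addr.
split=> i; case: (boolP (i \in finsupp T)) => [/le Ti|]; last first.
- by rewrite -cmE_eq0 => /eqP.
- by lia.
- by rewrite -cmE_eq0 => /eqP->; rewrite expn_gt0.
apply: leq_ltn_trans (ltn_expl _ (isT : 1 < 2)%N).
by apply: leq_trans Ti; apply: leq_addr.
Qed.

(** Besides homogeneity, the two statements of this section are all that is used
of Milnor's product formula. *)
Section Coproduct.
Variable p : nat -> nat.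
Hypothesis p_adm :
  forall i j, (0 < i)%N -> (0 < j)%N -> (p i - j <= p (i + j))%N.

(** Once the rows above agree, the digits of row [m] of [R] that the profile sees
are those digits of [T] that choose [i = 0]. *)
Lemma coproduct_dominated T R S m k : (dual_coproduct T)@_(R, S) != 0 ->
  rows_agree T p m.+1 R -> (k < p m.+1)%N -> bit (R m) k -> bit (T m) k.
Proof.
have [d [Td T0]] := expo_bounded T.
rewrite (coproduct_choices Td T0) raddf_sum /= => nz.
have [f Rf] : exists f : {ffun 'I_d * 'I_d -> 'I_d.+1}, R = left_mon T f.
  case: (pickP [pred f : {ffun 'I_d * 'I_d -> 'I_d.+1} | R == left_mon T f]) => [f /eqP|no].
    by exists f.
  case/eqP: nz; rewrite big1 // => f _; rewrite mcoeff_mono2 xpair_eqE.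
  by have /= -> := no f.
by rewrite Rf; apply: left_mon_dominated.
Qed.

Lemma coproduct_sig T S :
  (dual_coproduct T)@_(sig p T, S) = (mmul (sig p T) S == T)%:R.
Proof.
have [d [Td T0]] := expo_bounded T.
rewrite (coproduct_choices Td T0) raddf_sum /=.
have f0 := cut_choice_in T d p.
rewrite (bigD1 (cut_choice T d p)) //= big1 ?addr0; last first.
  move=> f /andP[fQ nf]; rewrite mcoeff_mono2 xpair_eqE; case: eqP => //= E.
  by case/eqP: nf; apply: (cut_choice_uniq p_adm fQ).
rewrite mcoeff_mono2 xpair_eqE left_mon_cut_choice // eqxx /=.
congr (nat_of_bool _)%:R; apply/eqP/eqP => [->|E].
  by rewrite -(left_mon_cut_choice Td T0 p) cut_choice_mul.
apply/eqP/cmP => i; move: E; rewrite -[in RHS](cut_choice_mul Td T0 p).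
rewrite left_mon_cut_choice // => /eqP/cmP/(_ i); rewrite !cmM.
exact: addnI.
Qed.
End Coproduct.

(** * Signatures and products *)

(** A criterion for the lexicographic order which does not see the order of the
positions with the same first component: at the first difference all rows
above agree, so there [f] must be 0 and [g] must be 1. *)
Lemma lexi_dominated (us : seq (nat * nat)) (f g : nat * nat -> bool) :
  sorted (fun u v => v.1 <= u.1)%N us ->
  (forall u, u \in us -> (forall v, v \in us -> (u.1 < v.1)%N -> f v = g v) ->
     f u -> g u) ->
  ((map f us : seqlexi bool) <= map g us)%O.
Proof.
elim: us => [|u us IH] // srt dom.
have top v : v \in us -> (v.1 <= u.1)%N.
  move: srt; rewrite /= path_sortedE; last by move=> a b c /= ab /leq_trans->.
  by case/andP=> /allP le _ /le.
have fg : f u -> g u.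
  apply: dom; rewrite ?mem_head // => v; rewrite inE => /orP[/eqP->|/top].
    by rewrite ltnn.
  by rewrite leqNgt => /negPf->.
rewrite /= Order.SeqLexiOrder.lexi_cons; apply/andP; split.
  by move: fg; case: (f u); case: (g u) => // /(_ isT).
apply/implyP => gf; apply: IH; first exact: path_sorted srt.
have fgu : f u = g u by move: fg gf; case: (f u); case: (g u) => // /(_ isT).
move=> w wus agr; apply: dom; rewrite ?inE ?wus ?orbT // => v.
by rewrite inE => /orP[/eqP->|/agr].
Qed.

Definition reduced (p : nat -> nat) (R : expo) := sig p R = R.

Section Signature.
Variables (p : nat -> nat) (Ps : seq (nat * nat)).
Hypothesis p_adm :
  forall i j, (0 < i)%N -> (0 < j)%N -> (p i - j <= p (i + j))%N.
Hypothesis Ps_mem : forall u, (u \in Ps) = (0 < u.1)%N && (u.2 < p u.1)%N.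
Hypothesis Ps_sorted : sorted (fun u v => v.1 <= u.1)%N Ps.

Lemma sig_reduced S : reduced p (sig p S).
Proof. by apply/eqP/cmP => i; rewrite !sigE modn_mod. Qed.

Lemma digitsE R : digits Ps R = [seq bit (rr R u.1) u.2 | u <- Ps].
Proof. by []. Qed.

Lemma bit_sig R t s : (0 < t)%N -> (s < p t)%N ->
  bit (rr (sig p R) t) s = bit (rr R t) s.
Proof. by case: t => // t _ sp; rewrite /rr /= sigE bit_mod sp. Qed.

Lemma digits_sig R : digits Ps (sig p R) = digits Ps R.
Proof.
rewrite !digitsE; apply/eq_in_map => u; rewrite Ps_mem => /andP[u1 u2].
exact: bit_sig.
Qed.

Lemma digits_inj R T : digits Ps R = digits Ps T -> sig p R = sig p T.
Proof.
rewrite !digitsE => /eq_in_map E; apply/eqP/cmP => i; rewrite !sigE.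
apply: bits_inj => k; rewrite !bit_mod; case: ltnP => //= kp.
by have := E (i.+1, k); rewrite Ps_mem => /(_ kp).
Qed.

Lemma sig_lt_irr R : ~~ sig_lt Ps R R.
Proof. by rewrite /sig_lt Order.POrderTheory.ltxx. Qed.

Lemma sig_lt_trans : transitive (sig_lt Ps).
Proof. by move=> S R T; apply: Order.POrderTheory.lt_trans. Qed.

Lemma sig_le_cases R T : (digits Ps R <= digits Ps T)%O ->
  sig p R = sig p T \/ sig_lt Ps (sig p R) (sig p T).
Proof.
rewrite Order.POrderTheory.le_eqVlt => /orP[/eqP/digits_inj|lt]; first by left.
by right; rewrite /sig_lt !digits_sig.
Qed.

(** [F_R A] is a right submodule of [A]. *)
Lemma coproduct_sig_le T R S : (dual_coproduct T)@_(R, S) != 0 ->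
  sig p R = sig p T \/ sig_lt Ps (sig p R) (sig p T).
Proof.
move=> nz; apply: sig_le_cases; rewrite !digitsE; apply: lexi_dominated => //.
move=> [[|t] s]; rewrite Ps_mem //= => sp agr.
apply: (coproduct_dominated p_adm nz) => // n k tn kp.
by apply: (agr (n.+1, k)); rewrite ?Ps_mem.
Qed.

Lemma sig1 : sig p mone = mone.
Proof. by apply/eqP/cmP => i; rewrite sigE cm1 mod0n. Qed.

Lemma sig_min S : sig p S = mone \/ sig_lt Ps mone (sig p S).
Proof.
have [|<-|lt] := @sig_le_cases mone S; first last.
- by right; rewrite -sig1.
- by left; apply: sig1.
rewrite !digitsE; apply: lexi_dominated => // -[t s] _ _ /=.
by rewrite /rr cm1 /bit div0n.
Qed.

Lemma sig_mul R S : reduced p R -> sig p (mmul R S) = R <-> sig p S = mone.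
Proof.
move=> rR; split=> E; apply/eqP/cmP => i.
  move/eqP/cmP/(_ i): E; rewrite -{2}rR !sigE cmM cm1 -[in RHS](addn0 (R i)).
  by move/eqP; rewrite eqn_modDl mod0n => /eqP.
move/eqP/cmP/(_ i): E; rewrite -{2}rR !sigE cmM cm1 => E.
by rewrite -modnDmr E addn0.
Qed.

Lemma mmul_divcm_sig T : mmul (sig p T) (divcm T (sig p T)) = T.
Proof. by apply/eqP/cmP => i; rewrite cmM divcmE sigE subnKC // leq_mod. Qed.

Lemma mmul_divcmK (R S : expo) : divcm (mmul R S) R = S.
Proof. by apply/eqP/cmP => i; rewrite divcmE cmM addKn. Qed.

Lemma pairing_neq0 (K : choiceType) (f : K -> 'F_2) x : pairing f x != 0 ->
  exists u, x@_u != 0 /\ f u != 0.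
Proof.
move=> nz.
case: (boolP (has (fun u => (x@_u != 0) && (f u != 0)) (msupp x))) => [/hasP[u _]|].
  by case/andP=> ? ?; exists u.
move=> /hasPn no; case/eqP: nz; rewrite /pairing big_seq big1 // => u /no.
by rewrite negb_and !negbK => /orP[] /eqP->; rewrite ?mul0r ?mulr0.
Qed.

Lemma steenrodM_supp (a b : steenrod) T : (scoef (a * b))@_T != 0 ->
  exists R S, [/\ (scoef a)@_R != 0, (scoef b)@_S != 0 &
                  (dual_coproduct T)@_(R, S) != 0].
Proof.
rewrite mcoeff_steenrodM => /pairing_neq0[[R S] [/= Tnz]].
by rewrite mulf_eq0 negb_or => /andP[aR bS]; exists R, S.
Qed.

Lemma SqM_supp R (b : steenrod) T : (scoef (Sq R * b))@_T != 0 ->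
  exists2 S, (scoef b)@_S != 0 & (dual_coproduct T)@_(R, S) != 0.
Proof.
move=> /steenrodM_supp[R' [S [+ bS nz]]]; rewrite mcoeffU.
by case: (eqVneq R R') => [->|_ /eqP //]; exists S.
Qed.

(** Modulo higher signatures, left multiplication by [Sq(R)] with [R = sig T]
is the shift [Sq(S) |-> Sq(R + S)]. *)
Lemma SqM_sig (b : steenrod) T :
  (scoef (Sq (sig p T) * b))@_T = (scoef b)@_(divcm T (sig p T)).
Proof.
(* the only term of [Delta xi^T] with left exponent [sig T] *)
pose u0 := (sig p T, divcm T (sig p T)).
rewrite mcoeff_steenrodM (pairingEw _ (fsubsetUr [fset u0]%fset (msupp _))).
rewrite (big_fsetD1 u0) ?in_fsetU ?in_fset1 ?eqxx // big_seq big1; last first.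
  case=> R S; rewrite in_fsetD1 => /andP[ne _]; rewrite [(R, S).1]/= [(R, S).2]/=.
  rewrite mcoeffU.
  case: (eqVneq (sig p T) R) ne => [<-|_] ne; last by rewrite mul0r mulr0.
  rewrite coproduct_sig //; case: eqP; rewrite ?mul0r // => E.
  by case/eqP: ne; rewrite /u0 -{3}E mmul_divcmK.
by rewrite /= addr0 coproduct_sig // mmul_divcm_sig eqxx mcoeffUU !mul1r.
Qed.
End Signature.

(** * Coefficients and supports *)

Section Coefficients.
Variable G : choiceType.
Implicit Types x y : {malg steenrod[G]}.

Definition ccoef (g : G) (S : expo) x : 'F_2 := (scoef x@_g)@_S.

Fact ccoef_is_additive g S : zmod_morphism (ccoef g S).
Proof. by move=> x y; rewrite /ccoef mcoeffB; apply: mcoeffB. Qed.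
HB.instance Definition _ g S :=
  GRing.isZmodMorphism.Build {malg steenrod[G]} 'F_2 (ccoef g S)
    (ccoef_is_additive g S).

Lemma ccoefP x y : (forall g S, ccoef g S x = ccoef g S y) -> x = y.
Proof. by move=> xy; apply/malgP => g; apply: steenrodP => S; apply: xy. Qed.

Lemma F2_cases (c : 'F_2) : c = 0 \/ c = 1.
Proof. by case: c => -[|[|[]]] // i; [left|right]; apply: val_inj. Qed.

Lemma scaleF2 (c : 'F_2) x : c%:A *: x = if c == 0 then 0 else x.
Proof.
by case: (F2_cases c) => ->; rewrite ?scale0r ?scale1r ?eqxx ?oner_eq0.
Qed.

Variable P : expo -> G -> Prop.

Lemma supported0 : supported P (0 : {malg steenrod[G]}).
Proof. by move=> S g; rewrite -[(scoef _)@_S]/(ccoef g S 0) raddf0 eqxx. Qed.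

Lemma supportedD x y : supported P x -> supported P y -> supported P (x + y).
Proof.
move=> hx hy S g; rewrite -[(scoef _)@_S]/(ccoef g S (x + y)) raddfD /=.
case: (eqVneq (ccoef g S x) 0) => [->|xnz _]; last exact: hx.
by rewrite add0r; apply: hy.
Qed.

Lemma supportedN x : supported P x -> supported P (- x).
Proof.
move=> hx S g; rewrite -[(scoef _)@_S]/(ccoef g S (- x)) raddfN oppr_eq0.
exact: hx.
Qed.

Lemma supportedB x y : supported P x -> supported P y -> supported P (x - y).
Proof. by move=> hx /supportedN; apply: supportedD. Qed.

Lemma supported_sum (I : Type) (r : seq I) (Q : pred I)
    (F : I -> {malg steenrod[G]}) :
  (forall i, Q i -> supported P (F i)) -> supported P (\sum_(i <- r | Q i) F i).
Proof.
move=> h; elim/big_rec: _ => [|i x Qi]; first exact: supported0.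
by apply: supportedD; apply: h.
Qed.

Lemma supportedF2 (c : 'F_2) x : supported P x -> supported P (c%:A *: x).
Proof. by rewrite scaleF2; case: ifP => // _ _; apply: supported0. Qed.
End Coefficients.

Lemma mcoeff_sumU (K : choiceType) (V : zmodType) (E : {fset K}) (Q : pred K)
    (F : K -> V) (k : K) :
  (\sum_(j <- E | Q j) << F j *g j >>)@_k =
    if (k \in E) && Q k then F k else 0.
Proof.
rewrite raddf_sum /=; case: (boolP (k \in E)) => [kE|kE] /=; last first.
  rewrite big_seq_cond big1 // => j /andP[jE _]; rewrite mcoeffU.
  by case: eqP kE jE => // -> /negPf->.
rewrite big_mkcond (big_fsetD1 k) //= big_seq big1 => [|j].
  by rewrite mcoeffUU addr0.
by rewrite in_fsetD1 => /andP[/negPf jk _]; rewrite mcoeffU jk; case: ifP.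
Qed.

Lemma malgU_scale (G : choiceType) (a : steenrod) (g : G) :
  << a *g g >> = a *: (<< g >> : {malg steenrod[G]}).
Proof. by apply/malgP => k; rewrite mcoeffZ !mcoeffU mulrnAr mulr1. Qed.

(** Linear maps move the coefficients by right multiplications only, so they
preserve supports defined by conditions on [S] alone that survive right
multiplication. *)
Lemma linear_supported (G H : choiceType)
    (phi : {linear {malg steenrod[G]} -> {malg steenrod[H]}}) (U : expo -> Prop) x :
  (forall T R S, (dual_coproduct T)@_(R, S) != 0 -> U R -> U T) ->
  supported (fun S _ => U S) x -> supported (fun S _ => U S) (phi x).
Proof.
move=> up xU; rewrite (monalgE x) raddf_sum /=; apply: supported_sum => g _ T h.
rewrite malgU_scale linearZ /= mcoeffZ => /steenrodM_supp[R [S [xR _ nz]]].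
exact: up nz (xU _ _ xR).
Qed.

Section Complex.
Variables (C : free_complex) (p : nat -> nat).

Lemma ccoef_Ecomp R k (x : cx C k) g S :
  ccoef g S (Ecomp p R x) = if sig p S == R then ccoef g S x else 0.
Proof.
rewrite /ccoef /Ecomp mcoeff_sumU andbT.
case: ifP => [_|/negbT gx] /=.
  rewrite mcoeff_sumU; case: ifP => [/andP[_ ->] //|].
  case: (boolP (S \in _)) => [_ /= -> //|/mcoeff_outdom ->].
  by case: ifP.
by rewrite (mcoeff_outdom gx) !mcoeff0; case: ifP.
Qed.

(** The inverse, on [E_R C], of the shift [Sq(S) g |-> Sq(R + S) g]. *)
Definition unshift R k (x : cx C k) : cx C k :=
  [malg g in msupp x => Steenrod [malg T in
     [fset divcm S R | S in msupp (scoef x@_g)]%fset => (scoef x@_g)@_(mmul R T)]].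

Lemma ccoef_unshift R k (x : cx C k) g T :
  ccoef g T (unshift R x) = ccoef g (mmul R T) x.
Proof.
rewrite /ccoef /unshift mcoeffE; case: ifP => [_|/negbT gx]; last first.
  by rewrite (mcoeff_outdom gx) !mcoeff0.
rewrite /= mcoeffE; case: ifP => // /negbT nT; apply/esym/mcoeff_outdom.
apply: contra nT => xS; apply/imfsetP; exists (mmul R T) => //=.
by rewrite mmul_divcmK.
Qed.
End Complex.

(** * The pieces of the filtration are shifts of the lowest one *)

Lemma subr_telescope (V : zmodType) (a b c d : V) :
  b - d = (a - c) + (c - d) - (a - b).
Proof. by rewrite subrKA opprB [RHS]addrC subrKA. Qed.

Section Graded.
Variables (C : free_complex) (p : nat -> nat) (Ps : seq (nat * nat)).
Hypothesis p_adm :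
  forall i j, (0 < i)%N -> (0 < j)%N -> (p i - j <= p (i + j))%N.
Hypothesis Ps_mem : forall u, (u \in Ps) = (0 < u.1)%N && (u.2 < p u.1)%N.
Hypothesis Ps_sorted : sorted (fun u v => v.1 <= u.1)%N Ps.

Notation inER := (Defs.inE p).
Notation inF := (inFgt p Ps).

Lemma bd_inFgt R k (x : cx C k) : inF R x -> inF R (bd C k x).
Proof.
apply: (linear_supported (U := fun S => sig_lt Ps R (sig p S))) => T R' S nz lt.
have [<- //|] := coproduct_sig_le p_adm Ps_mem Ps_sorted nz.
exact: sig_lt_trans.
Qed.

Lemma Ecomp_inE R k (x : cx C k) : inER R (Ecomp p R x).
Proof.
move=> S g; rewrite -[(scoef _)@_S]/(ccoef g S _) ccoef_Ecomp.
by case: (eqVneq (sig p S) R) => // _; rewrite eqxx.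
Qed.

Lemma Ecomp_in_deg R k q (x : cx C k) : in_deg q x -> in_deg q (Ecomp p R x).
Proof.
move=> xq S g; rewrite -[(scoef _)@_S]/(ccoef g S _) ccoef_Ecomp.
by case: (eqVneq (sig p S) R) => [_ /xq|_]; rewrite ?eqxx.
Qed.

Lemma sub_Ecomp (U : expo -> Prop) R k (x : cx C k) :
  supported (fun S _ => sig p S = R \/ U (sig p S)) x ->
  supported (fun S _ => U (sig p S)) (x - Ecomp p R x).
Proof.
move=> xU S g; rewrite -[(scoef _)@_S]/(ccoef g S _) raddfB /= ccoef_Ecomp.
case: (eqVneq (sig p S) R) => [_|/eqP ne]; first by rewrite subrr eqxx.
by rewrite subr0 => /xU[].
Qed.

Lemma scale_in_deg R q k (x : cx C k) :
  in_deg q x -> in_deg (sqdeg R + q) (Sq R *: x).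
Proof.
move=> xq T g; rewrite mcoeffZ => /SqM_supp[S /xq <- /homog2_coproduct <-].
by rewrite /sqdeg2 /= addnA.
Qed.

Section Shift.
Variable R : expo.
Hypothesis R_reduced : reduced p R.

Lemma scale_ge k (x : cx C k) T g : (scoef (Sq R *: x)@_g)@_T != 0 ->
  sig p T = R \/ sig_lt Ps R (sig p T).
Proof.
rewrite mcoeffZ => /SqM_supp[S _ /(coproduct_sig_le p_adm Ps_mem Ps_sorted)].
by rewrite R_reduced => -[]; [left|right].
Qed.

Lemma ccoef_scale k (x : cx C k) T g : sig p T = R ->
  ccoef g T (Sq R *: x) = ccoef g (divcm T R) x.
Proof. by move=> <-; rewrite /ccoef mcoeffZ (SqM_sig p_adm). Qed.

(** The coefficient of [Sq(R) x] at [R + S] is that of [x] at [S] whenever [S]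
has signature 0, and no product with [Sq(R)] has terms of signature below
[R].  The equivalence makes [Sq(R)] injective on [E_0 C], and so turns a
cycle condition in [E_R C] into one in [E_0 C]. *)
Lemma scale_inFgt k (x : cx C k) : inF R (Sq R *: x) <-> inF mone x.
Proof.
split=> xF S g nz.
  have [S0|//] := sig_min Ps_mem Ps_sorted S.
  have RS : sig p (mmul R S) = R by apply/sig_mul.
  have /xF : (scoef (Sq R *: x)@_g)@_(mmul R S) != 0.
    rewrite -[(scoef _)@__]/(ccoef g (mmul R S) _) ccoef_scale //.
    by rewrite mmul_divcmK.
  by rewrite RS (negPf (sig_lt_irr Ps R)).
have [SR|//] := scale_ge nz.
move: nz; rewrite -[(scoef _)@__]/(ccoef g S _) ccoef_scale // => /xF.
have /(sig_mul _ R_reduced) -> : sig p (mmul R (divcm S R)) = R.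
  by rewrite -{1 2}SR mmul_divcm_sig.
by rewrite (negPf (sig_lt_irr Ps mone)).
Qed.

Lemma inE_mul k (x : cx C k) S g : inER R x -> (scoef x@_g)@_S != 0 ->
  S = mmul R (divcm S R).
Proof. by move=> xR /xR <-; rewrite mmul_divcm_sig. Qed.

Lemma unshift_inE k (x : cx C k) : inER R x -> inER mone (unshift R x).
Proof.
move=> xR T g; rewrite -[(scoef _)@__]/(ccoef g T _) ccoef_unshift => /xR.
by move/sig_mul => ->.
Qed.

Lemma unshift_in_deg q k (x : cx C k) :
  in_deg q x -> in_deg (q - sqdeg R) (unshift R x).
Proof.
move=> xq T g; rewrite -[(scoef _)@__]/(ccoef g T _) ccoef_unshift => /xq <-.
by rewrite sqdegM -addnA addKn.
Qed.

Lemma scale_unshift k (x : cx C k) :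
  inER R x -> inF R (Sq R *: unshift R x - x).
Proof.
move=> xR T g; rewrite -[(scoef _)@__]/(ccoef g T _) raddfB /=.
case: (eqVneq (sig p T) R) => [TR|ne].
  rewrite ccoef_scale // ccoef_unshift.
  by rewrite -{1}TR -{1}TR mmul_divcm_sig subrr eqxx.
have -> : ccoef g T x = 0.
  by apply/eqP; apply: contraNT ne => /xR ->.
by rewrite subr0 => /scale_ge[/eqP|//]; rewrite (negPf ne).
Qed.
End Shift.

(** The vanishing of [H(E_R C)_(k,q)]: an element [e] of [E_R C] is a cycle for
the induced differential when [d e] lies in [F_(>R) C]. *)
Definition E_homology_zero R k q := forall e : cx C k,
  inER R e -> in_deg q e -> inF R (bd C k e) ->
  exists f : cx C k.+1, [/\ inER R f, in_deg q f & inF R (bd C k.+1 f - e)].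

(** Vanishing carries over along [H(E_R C)_(k,q) = H(E_0 C)_(k,q-|R|)].  The
premise [|R| <= q] guards against truncated subtraction; in degrees below
[|R|] the module [E_R C] is zero. *)
Lemma E_homology_shift R k q : reduced p R ->
  ((sqdeg R <= q)%N -> E_homology_zero mone k (q - sqdeg R)) ->
  E_homology_zero R k q.
Proof.
move=> rR H0 e eR eq de.
case: (leqP (sqdeg R) q) => qR; last first.
  have e0 : e = 0.
    apply: ccoefP => g S; rewrite [RHS]raddf0; apply/eqP/negPn/negP => nz.
    have := eq S g nz; rewrite (inE_mul eR nz) sqdegM.
    by move: qR; lia.
  exists 0; split; try exact: supported0.
  by rewrite e0 linear0 subrr; apply: supported0.
have {}H0 := H0 qR; pose e' := unshift R e.
have ee' : inF R (Sq R *: e' - e) by apply: scale_unshift.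
have [] := H0 e' (unshift_inE rR eR) (unshift_in_deg eq).
  apply: (proj1 (scale_inFgt rR (bd C k e'))).
  have -> : Sq R *: bd C k e' = bd C k (Sq R *: e' - e) + bd C k e.
    by rewrite linearB linearZ /= subrK.
  by apply: supportedD => //; apply: bd_inFgt.
move=> f' [f'E f'q df'].
have ff' : inF R (Sq R *: f' - Ecomp p R (Sq R *: f')).
  by apply: (sub_Ecomp (U := sig_lt Ps R)) => S g; apply: scale_ge.
exists (Ecomp p R (Sq R *: f')); split; first exact: Ecomp_inE.
  by apply: Ecomp_in_deg; rewrite -(subnKC qR); apply: scale_in_deg.
have -> : bd C k.+1 (Ecomp p R (Sq R *: f')) - e =
  Sq R *: (bd C k.+1 f' - e') + (Sq R *: e' - e)
  - bd C k.+1 (Sq R *: f' - Ecomp p R (Sq R *: f')).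
  by rewrite linearB linearZ /= scalerBr -subr_telescope.
apply: supportedB; last exact: bd_inFgt.
by apply: supportedD ee' => //; apply: (proj2 (scale_inFgt rR _) df').
Qed.
End Graded.

(** * Vanishing lines and the runs of the algorithm *)

Lemma subr_regroup (V : zmodType) (a b c e f : V) :
  a - b - c = (a - e) - (b - f) - (c - (e - f)).
Proof.
by rewrite [- (c - _)]opprB -[in LHS](subrK e a) -[in LHS](subrK f b) opprD
  addrACA -[LHS]addrA.
Qed.

Section Algorithm.
Variables (C : free_complex) (p : nat -> nat) (Ps : seq (nat * nat)).
Hypothesis p_adm :
  forall i j, (0 < i)%N -> (0 < j)%N -> (p i - j <= p (i + j))%N.
Hypothesis Ps_mem : forall u, (u \in Ps) = (0 < u.1)%N && (u.2 < p u.1)%N.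
Hypothesis Ps_sorted : sorted (fun u v => v.1 <= u.1)%N Ps.

Variable sigs : seq expo.
Hypothesis sigs_sorted : sorted (sig_lt Ps) sigs.
Hypothesis sigs_mem : forall R, R \in sigs <-> reduced p R /\ R <> mone.

Notation inER := (Defs.inE p).
Notation inF := (inFgt p Ps).
Notation Ezero := (E_homology_zero C p Ps).

(** For a final segment [L] of the ordered list of all signatures this is a
step of the filtration; the steps are indexed by lists so that one can induct
along them. *)
Definition sigs_in (L : seq expo) k (x : cx C k) : Prop :=
  supported (fun S _ => sig p S \in L) x.

Lemma sigs_in_nil k (x : cx C k) : sigs_in [::] x -> x = 0.
Proof.
move=> x0; apply: ccoefP => g S; rewrite [RHS]raddf0.
by apply/eqP/negPn/negP => /x0.
Qed.

Lemma bd_in_deg k q (x : cx C k) : in_deg q x -> in_deg q (bd C k x).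
Proof. by move=> xq; apply: bd_homog. Qed.

Lemma mone_lt_sigs R : R \in sigs -> sig_lt Ps mone R.
Proof.
by move=> /sigs_mem[rR R1]; case: (sig_min Ps_mem Ps_sorted R); rewrite rR.
Qed.

Lemma all_sigs_pairwise : pairwise (sig_lt Ps) (mone :: sigs).
Proof.
rewrite /= -(sorted_pairwise (@sig_lt_trans Ps)) sigs_sorted andbT.
by apply/allP => R; apply: mone_lt_sigs.
Qed.

(** [F_(>R) C] is the step of the filtration that follows [R]. *)
Lemma sig_lt_suffix pre R L S : mone :: sigs = pre ++ R :: L ->
  sig_lt Ps R (sig p S) = (sig p S \in L).
Proof.
move=> E; have := all_sigs_pairwise; rewrite E pairwise_cat allrel_consr /=.
case/and3P=> /andP[/allP preR _] _ /andP[/allP RL _].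
apply/idP/idP => [lt|/RL //].
have : sig p S \in mone :: sigs.
  rewrite inE; case: eqP => //= /eqP ne; apply/sigs_mem; split.
    exact: sig_reduced.
  exact/eqP.
rewrite E mem_cat inE => /or3P[/preR lt'|/eqP SR|//].
  by have := sig_lt_irr Ps R; rewrite (sig_lt_trans lt lt').
by move: lt; rewrite SR (negPf (sig_lt_irr Ps R)).
Qed.

Lemma inF_suffix pre R L k (x : cx C k) : mone :: sigs = pre ++ R :: L ->
  inF R x <-> sigs_in L x.
Proof.
by move=> E; split=> h S g /h; rewrite (sig_lt_suffix _ E).
Qed.

Lemma inF_mone k (x : cx C k) : inF mone x <-> sigs_in sigs x.
Proof. exact: (@inF_suffix [::]). Qed.

Lemma Ecomp_cycle R k (x : cx C k) : bd C k x = 0 ->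
  inF R (x - Ecomp p R x) -> inF R (bd C k (Ecomp p R x)).
Proof.
move=> dx xE; have -> : bd C k (Ecomp p R x) = - bd C k (x - Ecomp p R x).
  by rewrite linearB dx /= sub0r opprK.
by apply: supportedN; apply: bd_inFgt.
Qed.

Lemma sub_Ecomp_suffix pre R L k (x : cx C k) :
  mone :: sigs = pre ++ R :: L -> sigs_in (R :: L) x ->
  inF R (x - Ecomp p R x).
Proof.
move=> E xL; apply/(inF_suffix _ E).
apply: (sub_Ecomp (U := fun S => S \in L)) => S g /xL.
by rewrite inE => /orP[/eqP|]; [left|right].
Qed.

(** If the homology of every graded piece vanishes then so does that of a
filtration step: remove the components of [x] one after the other, from the
lowest signature on, by subtracting boundaries. *)
Lemma cycle_is_boundary L pre k q (x : cx C k) :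
  sigs = pre ++ L -> (forall R, R \in L -> Ezero R k q) ->
  in_deg q x -> bd C k x = 0 -> sigs_in L x ->
  exists f : cx C k.+1, [/\ sigs_in L f, in_deg q f & bd C k.+1 f = x].
Proof.
elim: L pre x => [|R L IH] pre x E H0 xq dx xL.
  exists 0; split; try exact: supported0.
  by rewrite linear0 (sigs_in_nil xL).
have E' : mone :: sigs = (mone :: pre) ++ R :: L by rewrite E.
have xE : inF R (x - Ecomp p R x) by apply: sub_Ecomp_suffix xL; apply: E'.
have [|||f [fR fq df]] := H0 R (mem_head _ _) (Ecomp p R x).
- exact: Ecomp_inE.
- exact: Ecomp_in_deg.
- exact: Ecomp_cycle.
have [|||||g [gL gq dg]] := IH (rcons pre R) (x - bd C k.+1 f).
- by rewrite cat_rcons.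
- by move=> T TL; apply: H0; rewrite inE TL orbT.
- by apply: supportedB => //; apply: bd_in_deg fq.
- by rewrite linearB dx (bd_bd f) subrr.
- apply: (proj1 (inF_suffix _ E')).
  have -> : x - bd C k.+1 f = (x - Ecomp p R x) - (bd C k.+1 f - Ecomp p R x).
    by rewrite opprB subrKA.
  exact: supportedB xE df.
exists (f + g); split.
- apply: supportedD => [S h /fR->|S h /gL SL]; first exact: mem_head.
  by rewrite inE SL orbT.
- exact: supportedD.
- by rewrite linearD dg addrC subrK.
Qed.

Variables (N t : nat).
Hypothesis N_gt0 : (0 < N)%N.
Hypothesis sigs_deg : forall R, R \in sigs -> (N <= sqdeg R)%N.
Hypothesis C_exact : forall k q, (q < t)%N -> (k, q) <> (0%N, 0%N) ->
  homology_zero C k q.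

(** The vanishing line [H(E_0 C)_(k,q) = 0] for [q < N k], by induction on [q]
along the exact sequence of [F_(>0) C], [C] and [E_0 C]. *)
Lemma E0_vanishing q k : (q < t)%N -> (q < N * k)%N -> Ezero mone k q.
Proof.
elim/ltn_ind: q k => q IH [|k] qt qk e eE eq de; first by rewrite muln0 in qk.
have [R Rs||||f [fF fq df]] := @cycle_is_boundary sigs [::] k q (bd C k.+1 e) erefl.
- have [rR _] := sigs_mem R; have NR := sigs_deg Rs.
  apply: E_homology_shift => // [|Rq]; first by case: (rR Rs).
  apply: IH; [lia | lia |].
  by rewrite ltn_subLR // (leq_trans qk) // mulnS leq_add2r.
- exact: (@bd_in_deg k.+1).
- exact: (bd_bd (p := k.+1) e).
- exact/inF_mone.
have [||y yq dy] := C_exact (k := k.+1) (q := q) qt _ (x := e - f).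
- by [].
- by split; [apply: supportedB | rewrite linearB df subrr].
exists (Ecomp p mone y); split; first exact: Ecomp_inE.
  exact: Ecomp_in_deg.
have -> : bd C k.+2 (Ecomp p mone y) - e = - f - bd C k.+2 (y - Ecomp p mone y).
  by rewrite linearB /= dy !opprB addrCA addKr.
apply: supportedB; first by apply: supportedN; apply/inF_mone.
apply: bd_inFgt => //; apply: (sub_Ecomp (U := sig_lt Ps mone)) => S g _.
exact: sig_min.
Qed.

(** Shifting by [|R| >= N] gains one column, and it leads to degrees below [t]
even when [q = t]. *)
Lemma E_vanishing R q k : R \in sigs -> (q <= t)%N -> (q < N * k.+1)%N ->
  Ezero R k q.
Proof.
move=> Rs qt qk; have NR := sigs_deg Rs.
apply: E_homology_shift => // [|Rq]; first by case/sigs_mem: Rs.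
apply: E0_vanishing; first by lia.
by rewrite ltn_subLR // (leq_trans qk) // mulnS leq_add2r.
Qed.

Variables (s m : nat) (x0 : 'I_m -> cx C s.+1).
Hypothesis t_small : (t < N * s.+1)%N.
Hypothesis x0_basis : E0_homology_basis p Ps t x0.

(** The signatures that were treated have disappeared from [d_i], while [x_i]
still represents the class it started from. *)
Lemma run_invariant Rs x d : signature_run p Ps t x0 Rs x d ->
  forall L, sigs = Rs ++ L -> forall i,
  [/\ in_deg t (x i), inF mone (x i - x0 i), d i = bd C s.+1 (x i) &
      sigs_in L (d i : cx C s)].
Proof.
elim=> [|{}Rs R {}x {}d f _ IH sol] L E i.
  have [/(_ i)[_ x0q [_ dx0]] _ _] := x0_basis.
  split=> //; first by rewrite subrr; apply: supported0.
  by move: E => /= <-; apply/inF_mone; rewrite -[bd _ _ _]subr0.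
have [|xt xE dE dL] := IH (R :: L) _ i; first by rewrite E cat_rcons.
have [fR ft [_ df]] := sol i.
have E' : mone :: sigs = (mone :: Rs) ++ R :: L by rewrite E cat_rcons.
have Rsigs : R \in sigs by rewrite E cat_rcons mem_cat mem_head orbT.
split.
- exact: supportedB.
- rewrite addrAC; apply: supportedB => // S g /fR ->.
  exact: mone_lt_sigs.
- by rewrite dE linearB.
apply: (proj1 (inF_suffix _ E')).
have -> : d i - bd C s.+1 (f i) =
  (d i - Ecomp p R (d i)) - (bd C s.+1 (f i) - Ecomp p R (d i)).
  by rewrite opprB subrKA.
by apply: supportedB df; apply: sub_Ecomp_suffix dL; apply: E'.
Qed.

Lemma run_solvable Rs R L x d : sigs = Rs ++ R :: L ->
  signature_run p Ps t x0 Rs x d ->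
  forall i, exists f, solves p Ps t R (Ecomp p R (d i)) f.
Proof.
move=> E run i; have [xt _ dE dL] := run_invariant run E i.
have E' : mone :: sigs = (mone :: Rs) ++ R :: L by rewrite E.
have Rsigs : R \in sigs by rewrite E mem_cat mem_head orbT.
have [|||f [fR ft df]] := @E_vanishing R t s Rsigs (leqnn t) t_small
  (Ecomp p R (d i : cx C s)).
- exact: Ecomp_inE.
- by apply: Ecomp_in_deg; rewrite dE; apply: (@bd_in_deg s.+1).
- apply: Ecomp_cycle; first by rewrite dE (bd_bd (p := s.+1)).
  by apply: sub_Ecomp_suffix dL; apply: E'.
by exists f; split=> //; split=> //; apply: Ecomp_inE.
Qed.

Lemma run_cycles x d : signature_run p Ps t x0 sigs x d ->
  forall i, [/\ d i = 0, in_deg t (x i) & bd C s.+1 (x i) = 0].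
Proof.
move=> run i; have [xt _ dE dL] := run_invariant run (esym (cats0 _)) i.
by have d0 := sigs_in_nil dL; split=> //; rewrite -dE.
Qed.

(** The [x_i] generate [H(C)_(s,t)]: the basis of [H(E_0 C)_(s,t)] accounts for
the component of signature 0 of a cycle, and what remains bounds in [C]. *)
Lemma run_generates x d : signature_run p Ps t x0 sigs x d ->
  forall y : cx C s.+1, in_deg t y -> bd C s.+1 y = 0 ->
  exists (c : 'I_m -> 'F_2) (w : cx C s.+2),
    in_deg t w /\ y = \sum_i (c i)%:A *: x i + bd C s.+2 w.
Proof.
move=> run y yt dy.
have yE : inF mone (y - Ecomp p mone y).
  apply: (sub_Ecomp (U := sig_lt Ps mone)) => S g _; exact: sig_min.
have [_ _ /(_ (Ecomp p mone y))[]] := x0_basis.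
  split; [exact: Ecomp_inE | exact: Ecomp_in_deg |].
  split; first exact: supported0.
  by rewrite subr0; apply: Ecomp_cycle.
move=> c [z [zE zt [_ dz]]].
pose u := y - \sum_i (c i)%:A *: x i - bd C s.+2 z.
have xsum_t : in_deg t (\sum_i (c i)%:A *: x i).
  by apply: supported_sum => i _; apply: supportedF2; case: (run_cycles run i).
have [R Rs||||w [_ wt dw]] := @cycle_is_boundary sigs [::] s.+1 t u erefl.
- by apply: E_vanishing => //; apply: (leq_trans t_small); rewrite leq_mul2l leqnSn orbT.
- apply: supportedB; first exact: supportedB.
  exact: (@bd_in_deg s.+2).
- rewrite !linearB /= dy (bd_bd (p := s.+2)) linear_sum /= big1 ?subr0 //.
  by move=> i _; rewrite linearZ /=; case: (run_cycles run i) => _ _ ->; rewrite scaler0.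
- apply: (proj1 (inF_mone _)).
  have -> : u = (y - Ecomp p mone y) - (\sum_i (c i)%:A *: (x i - x0 i))
    - (bd C s.+2 z - (Ecomp p mone y - \sum_i (c i)%:A *: x0 i)).
    under eq_bigr => i _ do rewrite scalerBr.
    by rewrite sumrB -subr_regroup.
  apply: supportedB; last exact: dz.
  apply: supportedB; first exact: yE.
  apply: supported_sum => i _; apply: supportedF2.
  by have [_ xE _ _] := run_invariant run (esym (cats0 _)) i.
exists c, (z + w); split; first exact: supportedD.
by rewrite linearD dw /u [X in _ + X]addrC subrK addrC subrK.
Qed.
End Algorithm.

(** * Adjoining generators *)

Section LinearExtension.
Variables (G : choiceType) (V : lmodType steenrod) (phi : G -> V).
Implicit Types x y : {malg steenrod[G]}.

Definition lin_ext x : V := \sum_(g <- msupp x) x@_g *: phi g.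

Lemma lin_extEw x (E : {fset G}) : (msupp x `<=` E)%fset ->
  lin_ext x = \sum_(g <- E) x@_g *: phi g.
Proof.
move=> le; rewrite /lin_ext (big_fset_incl _ le) // => g _.
by move/mcoeff_outdom->; rewrite scale0r.
Qed.

Fact lin_ext_is_linear : linear lin_ext.
Proof.
move=> a x y; pose E := (msupp x `|` msupp y)%fset.
have ax : (msupp (a *: x + y) `<=` E)%fset.
  by apply: fsubset_trans (msuppD_le _ _) _; apply: fsetSU; apply: msuppZ_le.
rewrite (lin_extEw ax) (lin_extEw (fsubsetUl _ _ : (_ `<=` E)%fset)).
rewrite (lin_extEw (fsubsetUr _ _ : (_ `<=` E)%fset)).
rewrite scaler_sumr -big_split /=; apply: eq_bigr => g _.
by rewrite mcoeffD mcoeffZ scalerDl scalerA.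
Qed.
HB.instance Definition _ :=
  GRing.isLinear.Build steenrod {malg steenrod[G]} V *:%R lin_ext
    lin_ext_is_linear.

Lemma lin_extU g : lin_ext << g >> = phi g.
Proof.
by rewrite (lin_extEw (msuppU_le (k := g))) big_seq_fset1 mcoeffUU scale1r.
Qed.
End LinearExtension.

Lemma eq_linear (G : choiceType) (V : lmodType steenrod)
    (phi psi : {linear {malg steenrod[G]} -> V}) :
  (forall g, phi << g >> = psi << g >>) -> phi =1 psi.
Proof.
move=> E x; rewrite (monalgE x) !raddf_sum; apply: eq_bigr => g _.
by rewrite /= malgU_scale !linearZ_LR /= E.
Qed.

Section Push.
Variables (G H : choiceType) (f : G -> H).
Implicit Types x y : {malg steenrod[G]}.

Lemma pushE x : push f x = lin_ext (fun g => << f g >>) x.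
Proof. by apply: eq_bigr => g _; rewrite malgU_scale. Qed.

Fact push_is_linear : linear (push f).
Proof. by move=> a x y; rewrite !pushE linearP. Qed.
HB.instance Definition _ :=
  GRing.isLinear.Build steenrod {malg steenrod[G]} {malg steenrod[H]} *:%R
    (push f) push_is_linear.

Lemma pushU g : push f << g >> = << f g >>.
Proof. by rewrite pushE lin_extU. Qed.

Lemma push_onto (z : {malg steenrod[H]}) :
  (forall h, z@_h != 0 -> exists g, h = f g) -> exists x, push f x = z.
Proof.
rewrite {2}(monalgE z) => fz.
have: all (fun h => z@_h != 0) (msupp z) by apply/allP => h; rewrite mcoeff_neq0.
elim: (enum_fset (msupp z)) => [_|h r IH /= /andP[zh /IH[x xE]]].
  by exists 0; rewrite linear0 big_nil.
have [g hE] := fz h zh.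
exists (z@_h *: << g >> + x).
by rewrite linearD linearZ /= pushU xE big_cons -hE -malgU_scale.
Qed.

Hypothesis f_inj : injective f.

Lemma push_coef x g : (push f x)@_(f g) = x@_g.
Proof.
rewrite [in RHS](monalgE x) /push !raddf_sum; apply: eq_bigr => k _ /=.
by rewrite !mcoeffU (inj_eq f_inj).
Qed.

Lemma push_inj : injective (push f).
Proof. by move=> x y E; apply/malgP => g; rewrite -!push_coef E. Qed.

Variables (dG : G -> nat) (dH : H -> nat).
Hypothesis f_deg : forall g, dH (f g) = dG g.

Lemma homog_push q x : homog dH q (push f x) <-> homog dG q x.
Proof.
split=> xq S h nz; first by rewrite -f_deg; apply: xq; rewrite push_coef.
case: (boolP (has (fun g => f g == h) (msupp x))) => [/hasP[g _ /eqP gh]|].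
  by move: nz; rewrite -gh push_coef f_deg => /xq.
move=> /hasPn no; case/eqP: nz.
rewrite /push raddf_sum /= big_seq big1; first exact: mcoeff0.
by move=> g /no ne; rewrite mcoeffU (negPf ne).
Qed.
End Push.

Lemma homog_scale (G : choiceType) (dG : G -> nat) d r (a : steenrod) y :
  (forall R, (scoef a)@_R != 0 -> (sqdeg R + d)%N = r) ->
  homog dG d y -> homog dG r (a *: y).
Proof.
move=> ar yd T g; rewrite mcoeffZ => /steenrodM_supp[R [S [/ar <- /yd <-]]].
by move/homog2_coproduct; rewrite /sqdeg2 /= addnA => ->.
Qed.

Lemma homogU (G : choiceType) (dG : G -> nat) g :
  homog dG (dG g) (<< g >> : {malg steenrod[G]}).
Proof.
move=> S h; rewrite mcoeffU; case: (eqVneq g h) => [<-|_]; last first.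
  by rewrite mulr0n -[scoef 0]/(0 : {malg 'F_2[expo]}) mcoeff0 eqxx.
by rewrite mulr1n mcoeffU; case: (eqVneq mone S) => [<-|_ /eqP //]; rewrite sqdeg1.
Qed.

Section NewGenerators.
Variables (C : free_complex) (s t m : nat) (x : 'I_m -> cx C s).
Hypotheses (x_deg : forall i, in_deg t (x i)) (x_cycle : forall i, bd C s (x i) = 0).

(** The new generators exist in every homological degree [q], indexed by
['I_m] restricted by the condition [q = s + 1]: this gives a uniform
definition of the modules [C'_q], without a case distinction in their type. *)
Definition new_index q : choiceType := {i : 'I_m | q == s.+1}.
Definition new_gen q : choiceType := (gen C q + new_index q)%type.
Definition new_deg q (b : new_gen q) : nat :=
  match b with inl a => gdeg a | inr _ => t end.

Definition transport k (e : s.+1 = k) (i : 'I_m) : cx C k.-1 :=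
  match e in _ = k return cx C k.-1 with erefl => x i end.

Lemma transport_cycle k (e : s.+1 = k) i :
  in_deg t (transport e i) /\ bd C k.-1 (transport e i) = 0.
Proof. by case: k / e. Qed.

Definition attach q (u : new_index q) : cx C q.-1 :=
  transport (esym (eqP (svalP u))) (sval u).

Lemma attachE (i : 'I_m) (e : s.+1 == s.+1) : attach (exist _ i e) = x i.
Proof. by rewrite /attach /= (eq_axiomK (esym _)). Qed.

Definition old q : gen C q -> new_gen q := inl.

Definition new_bd q : {malg steenrod[new_gen q]} -> {malg steenrod[new_gen q.-1]} :=
  lin_ext (fun b : new_gen q => push (@old q.-1)
    match b with inl a => bd C q << a >> | inr u => attach u end).
HB.instance Definition _ q := GRing.Linear.on (@new_bd q).

Lemma old_inj q : injective (@old q).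
Proof. by move=> a b []. Qed.

Lemma new_bdU q (b : new_gen q) : new_bd << b >> = push (@old q.-1)
    match b with inl a => bd C q << a >> | inr u => attach u end.
Proof. exact: lin_extU. Qed.

Lemma new_bd_push q (y : cx C q) :
  new_bd (push (@old q) y) = push (@old q.-1) (bd C q y).
Proof.
apply: (eq_linear (phi := @new_bd q \o push (@old q))
  (psi := push (@old q.-1) \o bd C q)) => a /=.
by rewrite pushU new_bdU.
Qed.

Fact new_finite q r : exists l : seq (new_gen q), forall g, new_deg g = r -> g \in l.
Proof.
have [l lP] := @gen_finite C q r.
exists (map inl l ++ map inr (enum {: {i : 'I_m | q == s.+1}})) => -[a|u] /= deg.
  by rewrite mem_cat map_f ?lP.
by rewrite mem_cat [X in _ || X]map_f ?orbT // mem_enum.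
Qed.

Fact new_bd_homog q r (z : {malg steenrod[new_gen q]}) :
  homog (@new_deg q) r z -> homog (@new_deg q.-1) r (new_bd z).
Proof.
move=> zr; rewrite /new_bd /lin_ext; apply: supported_sum => b _.
apply: (homog_scale (d := new_deg b)) => [R|]; first exact: zr.
apply: (proj2 (homog_push (@old_inj _) (dG := @gdeg C q.-1) _ _ _)) => //.
case: b => [a|u]; first by apply: bd_homog; apply: homogU.
by have [] := transport_cycle (esym (eqP (svalP u))) (sval u).
Qed.

Fact new_bd_bottom z : @new_bd 0 z = 0.
Proof.
apply: (eq_linear (phi := @new_bd 0) (psi := \0)) => -[a|[i]] //=.
by rewrite new_bdU bd_bottom linear0.
Qed.

Fact new_bd_bd q z : new_bd (@new_bd q z) = 0.
Proof.
apply: (eq_linear (phi := @new_bd q.-1 \o @new_bd q) (psi := \0)) => b /=.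
rewrite new_bdU new_bd_push; case: b => [a|u].
  by rewrite bd_bd linear0.
have [_ du] := transport_cycle (esym (eqP (svalP u))) (sval u).
by rewrite /attach du linear0.
Qed.

Definition new_complex : free_complex :=
  @FreeComplex new_gen new_deg (fun q => @new_bd q) new_finite new_bd_homog
    new_bd_bottom new_bd_bd.

Lemma adjoins_exists : exists C', adjoins t x C'.
Proof.
exists new_complex, old, (fun i => inr (exist _ i (eqxx s.+1))); split=> //.
- by split=> // [q|i j [] //]; apply: old_inj.
- split=> [q qs [a|[i e]]|[a|[i e]]]; first by exists a.
  + by case: qs; apply/eqP.
  + by left; exists a.
  + by right; exists i; congr (inr (exist _ _ _)); apply: bool_irrelevance.
- by move=> q a; rewrite [LHS]new_bdU.
- by move=> i; rewrite [LHS]new_bdU attachE.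
Qed.
End NewGenerators.

(** Outside bidegrees [(s+1, q)] with [q >= t] the two complexes have the same
elements, so every cycle to be killed comes from [C]; at [(s,t)] the new
generators bound the [x_i]. *)
Lemma adjoins_homology_zero (C : free_complex) (s t m : nat) (x : 'I_m -> cx C s) C' :
  (forall q r, (q < s)%N \/ (r < t)%N -> (q, r) <> (0%N, 0%N) ->
     homology_zero C q r) ->
  (forall y : cx C s, in_deg t y -> bd C s y = 0 ->
     exists (c : 'I_m -> 'F_2) (w : cx C s.+1),
       in_deg t w /\ y = \sum_i (c i)%:A *: x i + bd C s.+1 w) ->
  adjoins t x C' ->
  forall q r, (q, r) <> (0%N, 0%N) ->
    [\/ (q < s)%N, (r < t)%N | q = s /\ r = t] -> homology_zero C' q r.
Proof.
move=> exact_below generate [f [g [[f_inj g_inj fg] [f_surj f_or_g] [f_deg g_deg]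
  bd_f bd_g]]].
have bd_push k (y : cx C k) : bd C' k (push (f k) y) = push (f k.-1) (bd C k y).
  apply: (eq_linear (phi := bd C' k \o push (f k))
    (psi := push (f k.-1) \o bd C k)) => a /=.
  by rewrite pushU bd_f.
have push_deg k d (y : cx C k) : in_deg d (push (f k) y) <-> in_deg d y.
  exact: homog_push.
have pull k d (z : cx C' k) : in_deg d z -> bd C' k z = 0 ->
    k <> s.+1 \/ (d < t)%N ->
    exists y : cx C k, [/\ push (f k) y = z, in_deg d y & bd C k y = 0].
  move=> zd dz old.
  have [h zh|y yz] := @push_onto _ _ (f k) z.
    case: (eqVneq k s.+1) => [ks|/eqP/f_surj//]; subst k.
    case: old => // dt; case: (f_or_g h) => // -[i hi].
    have [S zS] : exists S, (scoef z@_h)@_S != 0.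
      case: (boolP (has (fun S => (scoef z@_h)@_S != 0) (msupp (scoef z@_h)))).
        by case/hasP => S _; exists S.
      move=> /hasPn no; case/eqP: zh; apply: steenrodP => S.
      rewrite [RHS]mcoeff0; case: (boolP (S \in msupp (scoef z@_h))) => [/no|].
        by rewrite negbK => /eqP.
      by move/mcoeff_outdom.
    by have := zd _ _ zS; rewrite hi g_deg => E; move: dt; rewrite -E ltnNge leq_addl.
  exists y; split=> //; first by apply: (proj1 (push_deg k d y)); rewrite yz.
  by apply: (push_inj (@f_inj k.-1)); rewrite -bd_push yz dz linear0.
move=> q r qr0 dom z [zr dz].
have [|y [yz yr dy]] := pull q r z zr dz.
  case: dom => [qs|rt|[-> _]]; [left; lia | by right | left; lia].
have lift (w : cx C q.+1) : in_deg r w -> bd C q.+1 w = y -> boundary r z.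
  move=> wr dw; exists (push (f q.+1) w); first exact: (proj2 (push_deg _ _ _)).
  by rewrite bd_push dw.
case: dom => [qs|rt|[qs rt]].
- have [w wr dw] := exact_below q r (or_introl qs) qr0 y (conj yr dy).
  exact: lift dw.
- have [w wr dw] := exact_below q r (or_intror rt) qr0 y (conj yr dy).
  exact: lift dw.
subst q r; have [c [w [wt yE]]] := generate y yr dy.
exists (\sum_i (c i)%:A *: << g i >> + push (f s.+1) w).
  apply: supportedD; last exact: (proj2 (push_deg _ _ _)).
  apply: supported_sum => i _; apply: supportedF2; rewrite -(g_deg i).
  exact: homogU.
rewrite linearD linear_sum /= bd_push -yz yE linearD linear_sum /=.
by congr (_ + _); apply: eq_bigr => i _; rewrite !linearZ /= bd_g.
Qed.

Theorem theorem4p1 (n : nat) (B : steenrod -> Prop) (p : nat -> nat)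
    (Ps : seq (nat * nat)) (sigs : seq expo) (C : free_complex) (s t : nat) :
  admissible B p ->
  (forall b, B b -> Fsub n b) ->
  Pts_enum B Ps ->
  signature_enum B Ps sigs ->
  partial_resolution C s t ->
  (t < (2 ^ n.+1 - 1) * s)%N ->
  forall (m : nat) (x0 : 'I_m -> {malg steenrod[gen C s]}),
  E0_homology_basis p Ps t x0 ->
  (forall Rs R Rs' x d, sigs = Rs ++ R :: Rs' ->
     signature_run p Ps t x0 Rs x d ->
     forall i, exists f, solves p Ps t R (Ecomp p R (d i)) f) /\
  (forall x d, signature_run p Ps t x0 sigs x d ->
     (forall i, d i = 0) /\
     (exists C', adjoins t x C') /\
     (forall C', adjoins t x C' ->
        forall q r, (q, r) <> (0%N, 0%N) ->
          [\/ (q < s)%N, (r < t)%N | q = s /\ r = t] ->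
          homology_zero C' q r)).
Proof.
move=> [_ _ B_prof p_adm] B_F [_ Ps_B Ps_sorted] [sigs_sorted sigs_B] [C_res _].
case: s C_res => [|s] C_res t_small; first by rewrite muln0 in t_small.
have BSq R : B (Sq R) <-> in_profile p R.
  rewrite (B_prof (Sq R)); split=> [h|pR S].
    by apply: h; rewrite mcoeffU eqxx.
  by rewrite mcoeffU; case: (eqVneq R S) => [<-|_ /eqP].
have Ps_mem u : (u \in Ps) = (0 < u.1)%N && (u.2 < p u.1)%N.
  case: u => [[|i] j] /=; first by apply/negP => /Ps_B[].
  apply/idP/idP => [/Ps_B[_ /BSq/(_ i.+1 isT)]|jp].
    by rewrite /rr /= -/(upow _ _) cmE fsfun_fun in_fset1 eqxx ltn_exp2l.
  apply/Ps_B; split=> //; apply/BSq => -[|k] // _.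
  rewrite /rr /= cmE fsfun_fun in_fset1; case: eqP => [->|_].
    by rewrite ltn_exp2l.
  by rewrite expn_gt0.
have reducedP R : in_profile p R <-> reduced p R.
  split=> [pR|<- [|j] // _]; last by rewrite /rr /= sigE ltn_mod expn_gt0.
  by apply/(sigP p R R).
have sigs_mem R : R \in sigs <-> reduced p R /\ R <> mone.
  by rewrite sigs_B BSq reducedP.
have sigs_deg R : R \in sigs -> (2 ^ n.+1 - 1 <= sqdeg R)%N.
  move=> /sigs_B[BR R1].
  have [i Ri] : exists i, i \in finsupp R.
    case: (fset_0Vmem (finsupp R)) => [R0|[i iR]]; last by exists i.
    by case: R1; apply: mdeg_eq0I; rewrite mdegE R0 big_seq_fset0.
  have ni : (n <= i)%N.
    rewrite leqNgt; apply/negP => lt; move: Ri; rewrite -cmE_neq0.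
    have := B_F _ BR R; rewrite mcoeffU eqxx => /(_ isT i.+1).
    by rewrite /rr /= => ->.
  rewrite /sqdeg (big_fsetD1 i) //= (leq_trans _ (leq_addr _ _)) //.
  rewrite -cmE_neq0 -lt0n in Ri.
  rewrite (leq_trans _ (leq_pmull _ Ri)) // -subn1 leq_sub2r //.
  by rewrite leq_exp2l.
have N_gt0 : (0 < 2 ^ n.+1 - 1)%N.
  by rewrite subn_gt0 -{1}(expn0 2) ltn_exp2l.
have C_exact k q : (q < t)%N -> (k, q) <> (0%N, 0%N) -> homology_zero C k q.
  by move=> qt; apply: C_res; right.
move=> m x0 x0_basis; split=> [Rs R L x d E run|x d run].
  exact: (run_solvable p_adm Ps_mem Ps_sorted sigs_sorted sigs_mem N_gt0 sigs_deg
    C_exact t_small x0_basis E run).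
have cyc := run_cycles Ps_mem Ps_sorted sigs_sorted sigs_mem x0_basis run.
split; first by move=> i; case: (cyc i).
split; first by apply: adjoins_exists => i; case: (cyc i).
move=> C'; apply: adjoins_homology_zero => [q r qr|].
  exact: C_res.
exact: (run_generates p_adm Ps_mem Ps_sorted sigs_sorted sigs_mem N_gt0 sigs_deg
    C_exact t_small x0_basis run).
Qed.
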